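(* Assume that $\gamma=(x(\cdot),t(\cdot))$ is $C^1$ and that, for some $\tau_0\in(0,T)$, $t'(\tau)<0$ for all $\tau\in(\tau_0,T]$. Then $u_\infty$ is locally bounded in $Q_T\setminus\gamma([0,\tau_0])$.
   Context: Let $N\ge1$, $T>0$, $p>1$, $Q_T:=\mathbb{R}^N\times(0,T)$. Let $\Gamma=\{\gamma(\tau):=(x(\tau),t(\tau)):\tau\in[0,T]\}\subset\overline{Q_T}$ be a curve, where $\gamma:[0,T]\to\mathbb{R}^N\times[0,T]$ is Lipschitz and one-to-one, $\gamma(0)=(0,0)$ and $t(\tau)>0$ for $\tau\in(0,T]$. Let $h\in C(\overline{Q_T})$ satisfy $h=0$ on $\Gamma$ and $h>0$ on $\overline{Q_T}\setminus\Gamma$, and let $E(x,t)=(4\pi t)^{-N/2}e^{-|x|^2/4t}$ be the heat kernel. It is assumed that for every $R>0$ (with $B_R=\{x\in\mathbb{R}^N:|x|<R\}$) $$\int_0^T\int_{B_R}h(x,t)E^p(x,t)\,dx\,dt<\infty .$$ For $k>0$, $u_k$ denotes the unique nonnegative solution of $\partial_tu-\Delta u+h(x,t)u^p=0$ in $Q_T$ with $u_k(\cdot,0)=k\delta_0$, that is, $u_k\in C(\overline{Q_T}\setminus\{(0,0)\})\cap L^1(Q_T)$, $hu_k^p\in L^1(Q_T)$ and $$\iint_{Q_T}\left(-u_k\partial_t\zeta-u_k\Delta\zeta+hu_k^p\zeta\right)dx\,dt=k\,\zeta(0,0)$$ for all compactly supported $\zeta\in C^{2,1}(\overline{Q_T})$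 vanishing at $t=T$. The map $k\mapsto u_k$ is increasing, and $u_\infty:=\lim_{k\to\infty}u_k$ pointwise, with values in $[0,\infty]$. *)

(* Defs.v *)
From HB Require Import structures.
From mathcomp Require Import all_boot all_order all_algebra.
From mathcomp Require Import all_classical all_reals all_analysis.

Set Implicit Arguments.
Unset Strict Implicit.
Unset Printing Implicit Defensive.

Import Order.TTheory GRing.Theory Num.Theory.
Import numFieldNormedType.Exports.

Local Open Scope classical_set_scope.
Local Open Scope ring_scope.

(* The sigma-algebra on R^n is the product one, generated by the coordinates,
   as the library does for n.-tuple; it is the Borel sigma-algebra.           *)
Section measurable_rV.
Context {R : realType} (n : nat).

Let coors (i : 'I_n) (x : 'rV[R]_n) : R := x ord0 i.

Let rV_set0 : g_sigma_preimage coors set0.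
Proof. exact: sigma_algebra0. Qed.

Let rV_setC A : g_sigma_preimage coors A -> g_sigma_preimage coors (~` A).
Proof. exact: sigma_algebraC. Qed.

Let rV_bigcup (F : _^nat) : (forall i, g_sigma_preimage coors (F i)) ->
  g_sigma_preimage coors (\bigcup_i (F i)).
Proof. exact: sigma_algebra_bigcup. Qed.

HB.instance Definition _ := @isMeasurable.Build default_measure_display
  'rV[R]_n (g_sigma_preimage coors) rV_set0 rV_setC rV_bigcup.

Lemma measurable_coord (i : 'I_n) :
  measurable_fun [set: 'rV[R]_n] (fun x : 'rV[R]_n => x ord0 i).
Proof.
move=> _ Y mY; rewrite setTI; apply: sub_sigma_algebra => /=.
rewrite -bigcup_seq/=; exists i => /=; first by rewrite mem_index_enum.
by exists Y => //; rewrite setTI.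
Qed.

Lemma measurable_fun_rVP d (T : measurableType d) (f : T -> 'rV[R]_n) :
  (forall i, measurable_fun [set: T] (fun x => f x ord0 i)) ->
  measurable_fun [set: T] f.
Proof.
move=> mf.
have sub : g_sigma_preimage (fun i => coors i \o f) `<=` measurable.
  apply: smallest_sub; first exact: sigma_algebra_measurable.
  rewrite -bigcup_seq; apply: bigcup_sub => i _.
  by move=> A [B mB <-]; exact: mf.
rewrite g_sigma_preimage_comp in sub.
by move=> _ A mA; apply: sub; exists A.
Qed.

End measurable_rV.

Section cons_rV.
Context {R : realType} (n : nat).

Definition cons_rV (p : R * 'rV[R]_n) : 'rV[R]_n.+1 :=
  row_mx (p.1%:M : 'rV[R]_1) p.2.

Let cons_rV_head (p : R * 'rV[R]_n) (j : 'I_1) :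
  cons_rV p ord0 (lshift n j) = p.1.
Proof. by rewrite /cons_rV (@row_mxEl _ 1 1 n) mxE (ord1 j) mulr1n. Qed.

Let cons_rV_tail (p : R * 'rV[R]_n) (j : 'I_n) :
  cons_rV p ord0 (rshift 1 j) = p.2 ord0 j.
Proof. by rewrite /cons_rV (@row_mxEr _ 1 1 n). Qed.

Lemma measurable_cons_rV : measurable_fun [set: R * 'rV[R]_n] cons_rV.
Proof.
apply: measurable_fun_rVP => i; case: (@split_ordP 1 n i) => j ->.
  rewrite (_ : (fun x => _) = fst); first exact: measurable_fst.
  by apply/funext => p; exact: cons_rV_head.
rewrite (_ : (fun x => _) = (fun x : 'rV[R]_n => x ord0 j) \o snd).
  exact: (measurableT_comp (measurable_coord j) measurable_snd).
by apply/funext => p; exact: cons_rV_tail.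
Qed.

Let uncons_rV (x : 'rV[R]_n.+1) : R * 'rV[R]_n :=
  (x ord0 ord0, \row_j x ord0 (rshift 1 j)).

Let cons_rVK : cancel cons_rV uncons_rV.
Proof.
move=> [t x]; rewrite /uncons_rV; congr pair.
  by rewrite -[RHS](cons_rV_head (t, x) ord0); congr (cons_rV _ _ _); exact/val_inj.
by apply/rowP => j; rewrite mxE cons_rV_tail.
Qed.

Let measurable_uncons_rV : measurable_fun [set: 'rV[R]_n.+1] uncons_rV.
Proof.
apply: measurable_fun_pair; first exact: measurable_coord.
apply: measurable_fun_rVP => j.
under eq_fun do rewrite mxE.
exact: measurable_coord.
Qed.

Variable mu : {sigma_finite_measure set 'rV[R]_n -> \bar R}.

Definition lebesgue_cons : set 'rV[R]_n.+1 -> \bar R :=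
  pushforward (@lebesgue_measure R \x mu)%E cons_rV.

Let lebesgue_cons0 : lebesgue_cons set0 = 0%E.
Proof. by rewrite /lebesgue_cons /pushforward preimage_set0 measure0. Qed.

Let lebesgue_cons_ge0 A : (0 <= lebesgue_cons A)%E.
Proof. by have mf := measurable_cons_rV; exact: measure_ge0. Qed.

Let lebesgue_cons_sigma_additive : semi_sigma_additive lebesgue_cons.
Proof.
by have mf := measurable_cons_rV; exact: measure_semi_sigma_additive.
Qed.

HB.instance Definition _ := isMeasure.Build _ _ _
  lebesgue_cons lebesgue_cons0 lebesgue_cons_ge0 lebesgue_cons_sigma_additive.

Let lebesgue_cons_sigma_finite : sigma_finite setT lebesgue_cons.
Proof.
have [F TF Foo] : sigma_finite setT (@lebesgue_measure R \x mu)%E.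
  have /sigma_finiteP[F [TF ndF Foo]] := sigma_finiteT (@lebesgue_measure R).
  have /sigma_finiteP[G [TG ndG Goo]] := sigma_finiteT mu.
  exists (fun i => F i `*` G i).
    rewrite -setXTT TF TG predeqE => -[x y]; split.
      move=> [/= [i _ Fix] [k _ Gky]]; exists (maxn i k) => //; split.
      - by move: x Fix; exact/subsetPset/ndF/leq_maxl.
      - by move: y Gky; exact/subsetPset/ndG/leq_maxr.
    by move=> [i _ []/= ? ?]; split; exists i.
  move=> k; have [? ?] := Foo k; have [? ?] := Goo k.
  split; first exact: measurableX.
  by rewrite product_measure1E// lte_mul_pinfty// ge0_fin_numE.
exists (fun i => uncons_rV @^-1` F i).
  by rewrite -preimage_bigcup -TF preimage_setT.
move=> i; have [mF muF] := Foo i; split.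
  by rewrite -[X in measurable X]setTI; exact: measurable_uncons_rV.
rewrite /lebesgue_cons /pushforward -comp_preimage.
by rewrite (_ : uncons_rV \o cons_rV = id)//; apply/funext => p /=.
Qed.

HB.instance Definition _ := Measure_isSigmaFinite.Build _ _ _
  lebesgue_cons lebesgue_cons_sigma_finite.

End cons_rV.

(* Lebesgue measure on R^n: iterated product of the measure on R, starting
   from the unit mass on the one-point space R^0.                             *)
Fixpoint lebesgue_rV {R : realType} (n : nat) :
    {sigma_finite_measure set 'rV[R]_n -> \bar R} :=
  if n is m.+1 then lebesgue_cons (lebesgue_rV m) else \d_(0 : 'rV[R]_0).

Lemma lebesgue_rV_box {R : realType} (n : nat) (A : 'I_n -> set R) :
  (forall i, measurable (A i)) ->
  lebesgue_rV n [set x : 'rV[R]_n | forall i, A i (x ord0 i)] =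
  (\prod_(i < n) lebesgue_measure (A i))%E.
Proof.
elim: n A => [|n IH] A mA.
  rewrite big_ord0 /= diracE mem_set//=; by case.
rewrite big_ord_recl -IH//= /lebesgue_cons /pushforward.
rewrite -(@product_measure1E _ _ _ _ _ (@lebesgue_measure R) (lebesgue_rV n))//.
  congr (product_measure1 _ _ _); apply/seteqP; split => -[t x] /=.
    move=> H; split=> [|i].
      have := H ord0; rewrite /cons_rV /=.
      have -> : ord0 = lshift n (ord0 : 'I_1) by exact/val_inj.
      by rewrite (@row_mxEl _ 1 1 n) mxE.
    have := H (lift ord0 i); rewrite /cons_rV /=.
    have -> : lift ord0 i = rshift 1 i by exact/val_inj.
    by rewrite (@row_mxEr _ 1 1 n).
  move=> [H0 H] i; rewrite /cons_rV; case: (@split_ordP 1 n i) => j ji; rewrite ji.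
    rewrite (@row_mxEl _ 1 1 n) mxE (ord1 j) mulr1n/=.
    by have -> : lshift n (ord0 : 'I_1) = ord0 by exact/val_inj.
  rewrite (@row_mxEr _ 1 1 n) /=.
  by have <- : lift ord0 j = rshift 1 j by exact/val_inj.
  exact: mA.
rewrite (_ : [set _ | _] = \big[setI/setT]_(i < n)
    ((fun x : 'rV[R]_n => x ord0 i) @^-1` A (lift ord0 i))); last first.
  rewrite -bigcap_seq; apply/seteqP; split => x /= H i; first by move=> _; exact: H.
  by apply: H => /=; rewrite mem_index_enum.
apply: bigsetI_measurable => i _; rewrite -[X in measurable X]setTI.
exact: measurable_coord.
Qed.

Section heat_equation.
Context {R : realType} (N : nat).
Implicit Types (T p k : R) (z : 'rV[R]_N * R).

Definition enorm (x : 'rV[R]_N) : R := Num.sqrt (\sum_(i < N) x ord0 i ^+ 2).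

Definition eball (r : R) : set 'rV[R]_N := [set x | enorm x < r].

Definition heat_kernel (x : 'rV[R]_N) (t : R) : R :=
  (4 * pi * t) `^ (- (N%:R / 2)) * expR (- (enorm x ^+ 2 / (4 * t))).

Definition QT T : set ('rV[R]_N * R) := [set z | 0 < z.2 < T].

Definition spacetime_measure : set ('rV[R]_N * measurableTypeR R) -> \bar R :=
  (lebesgue_rV N \x @lebesgue_measure R)%E.

HB.instance Definition _ := Measure.on spacetime_measure.

Definition dirx (i : 'I_N) : 'rV[R]_N * R := (delta_mx ord0 i, 0).
Definition dirt : 'rV[R]_N * R := (0, 1).

Definition laplacian (f : 'rV[R]_N * R -> R) z : R :=
  \sum_(i < N) 'D_(dirx i) ('D_(dirx i) f) z.

(* f, considered on D only, extends continuously to the closure of D *)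
Definition continuous_up_to (D : set ('rV[R]_N * R)) (f : 'rV[R]_N * R -> R) :=
  exists2 g : 'rV[R]_N * R -> R,
    {within closure D, continuous g} & (forall z, D z -> g z = f z).

(* zeta \in C^{2,1}(closure of Q_T): the derivatives exist in the open set Q_T
   and extend continuously to its closure.                                    *)
Definition C21 T (zeta : 'rV[R]_N * R -> R) : Prop :=
  [/\ {within closure (QT T), continuous zeta},
      (forall z, QT T z -> derivable zeta z dirt) /\
        continuous_up_to (QT T) ('D_dirt zeta),
      (forall i, (forall z, QT T z -> derivable zeta z (dirx i)) /\
        continuous_up_to (QT T) ('D_(dirx i) zeta)) &
      (forall i j,
        (forall z, QT T z -> derivable ('D_(dirx i) zeta) z (dirx j)) /\
        continuous_up_to (QT T) ('D_(dirx j) ('D_(dirx i) zeta)))].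

Definition test_function T (zeta : 'rV[R]_N * R -> R) : Prop :=
  [/\ C21 T zeta,
      compact (closure (closure (QT T) `&` [set z | zeta z != 0])) &
      forall x : 'rV[R]_N, zeta (x, T) = 0].

Definition punctured_strip T : set ('rV[R]_N * R) :=
  closure (QT T) `\ ((0, 0) : 'rV[R]_N * R).

Definition heat_solution T p (h : 'rV[R]_N * R -> R) k
    (u : 'rV[R]_N * R -> R) : Prop :=
  [/\ {within punctured_strip T, continuous u},
      (forall z, punctured_strip T z -> 0 <= u z),
      spacetime_measure.-integrable (QT T) (EFin \o u),
      spacetime_measure.-integrable (QT T) (fun z => (h z * u z `^ p)%:E) &
      forall zeta, test_function T zeta ->
        (\int[spacetime_measure]_(z in QT T)
           (- u z * 'D_dirt zeta z - u z * laplacian zeta z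
            + h z * u z `^ p * zeta z)%:E)%E = (k * zeta (0, 0))%:E].

Definition unique_heat_solution T p h k u : Prop :=
  heat_solution T p h k u /\
  (forall v, heat_solution T p h k v ->
     forall z, punctured_strip T z -> v z = u z).

Definition u_infty (u : R -> 'rV[R]_N * R -> R) z : \bar R :=
  lim ((u k z)%:E @[k --> +oo]).

End heat_equation.

Arguments QT {R} N T.
Arguments punctured_strip {R} N T.

(* Derivative of f at s as a function on A only: one-sided at the endpoints
   when A is a closed interval.                                               *)
Section derivative_within.
Context {R : realType} {V : normedModType R}.
Variables (A : set R) (f : R -> V).

Definition quotient_within (s : R) : set_system V :=
  (r - s)^-1 *: (f r - f s) @[r --> within A s^'].

Definition derivable_within (s : R) : Prop := cvg (quotient_within s).

Definition derive_within (s : R) : V := lim (quotient_within s).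

Definition C1_within : Prop :=
  (forall s, A s -> derivable_within s) /\ {within A, continuous derive_within}.

End derivative_within.

Definition locally_bounded_on {R : realType} {X : topologicalType}
    (A : set X) (f : X -> \bar R) : Prop :=
  forall z, A z ->
    exists M : R, \forall y \near within A (nbhs z), (`|f y| <= M%:E)%E.

(* Main.v *)
Require Import Defs.
From mathcomp Require Import all_boot all_order all_algebra.
From mathcomp Require Import all_classical all_reals all_analysis.
From mathcomp Require Import measurable_realfun.
From mathcomp Require Import ring lra.

Set Implicit Arguments.
Unset Strict Implicit.
Unset Printing Implicit Defensive.

Import Order.TTheory GRing.Theory Num.Theory.
Import numFieldNormedType.Exports.

Local Open Scope classical_set_scope.
Local Open Scope ring_scope.

(** Off the curve the absorption term bounds all the solutions u_k by a common
    constant; around the backward part of the curve the heat operator carries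
    such bounds inwards from the lateral surface of a tube.  Both steps rest on
    one comparison principle.

    Comparison.  A very weak solution u is only continuous, so a maximum of
    u - V cannot be differentiated.  Instead u is averaged against the test
    functions [zeta], which are products of one-dimensional C^2 bumps centred
    at a movable point z.  Since zeta depends on the difference w - z only,
    differentiating the average in z amounts to testing the equation, and
    [weak_identity] with [is_derive_mollify] says that the average solves the
    heat equation with the averaged absorption as a sink, in the classical
    sense.  The total mass of zeta does not depend on z ([zeta_mass]), so
    the average can be compared with V pointwise, at the points where the
    difference is maximal over a compact set; this is [comparison].  Only
    supersolutions V that are sums of functions of a single coordinate occur,
    and uniform continuity of u on compact sets costs an additive constant,
    which is harmless for an upper bound.

    Off the curve.  Where h is bounded below by a positive constant, the sum over all
    coordinates (time included) of A (r^2 - s^2)^(-m) is a supersolution on a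
    box of radius r when m (p - 1) >= 2 and A is large.  It exceeds u near the
    boundary of the box, however large u is there; hence the bound
    [keller_osserman] near the centre is the same for all u.  Compactness extends
    it to compact sets that avoid the curve.

    On the backward part.  Let z1 be a point of the curve of parameter t1 > tau0.
    Choose tau0 < t2 < t3 < t1.  The arc G over [t3, T] is at positive distance
    from the arc over [0, t2], and the arc over ]t2, t3[ lies at times later than
    that of the parameter t3.  So, for b strictly between the times of the parameters
    t1 and t3 and e small, the points of the curve of time at most b that are
    within e of G lie on G itself.  The tube of points within e of G and of
    time at most b therefore has its whole lateral surface (where the distance
    to G is e) off the curve; this includes the bottom of the tube, because G
    ends inside it.  There u is bounded by the previous step, and the maximum
    principle, which asks nothing at the top time b, bounds u in the tube:
    this is [tube_bound], with the supersolution M + 1 + time. *)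

(** * Calculus in one variable *)

Section bump.
Context {R : realType}.
Implicit Types (e s x : R).

(** The differentiation rules for explicit functions of one real variable: the
    pointwise operations on functions do not unify with a lambda-term. *)
Lemma is_derive1X (f : R -> R) n x df : is_derive x 1 f df ->
  is_derive x 1 (fun y => f y ^+ n) (n%:R * f x ^+ n.-1 * df).
Proof. by move=> H; have := is_deriveX n H; rewrite exprfctE. Qed.

Lemma is_derive1M (f g : R -> R) x df dg : is_derive x 1 f df -> is_derive x 1 g dg ->
  is_derive x 1 (fun y => f y * g y) (f x * dg + g x * df).
Proof. by move=> H K; have := is_deriveM H K. Qed.

Lemma is_derive1Ml k (f : R -> R) x df : is_derive x 1 f df ->
  is_derive x 1 (fun y => k * f y) (k * df).
Proof. by move=> H; have := is_deriveZ k H. Qed.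

Lemma is_derive1B (f g : R -> R) x df dg : is_derive x 1 f df -> is_derive x 1 g dg ->
  is_derive x 1 (fun y => f y - g y) (df - dg).
Proof. by move=> H K; have := is_deriveB H K. Qed.

Lemma is_derive1D (f g : R -> R) x df dg : is_derive x 1 f df -> is_derive x 1 g dg ->
  is_derive x 1 (fun y => f y + g y) (df + dg).
Proof. by move=> H K; have := is_deriveD H K. Qed.

Lemma is_derive1_chain (f g : R -> R) x a b : is_derive (g x) 1 f a -> is_derive x 1 g b ->
  is_derive x 1 (fun y => f (g y)) (a * b).
Proof. exact: is_derive1_comp. Qed.

Lemma is_derive1_shift (f : R -> R) (c x a : R) : is_derive (c + x) 1 f a ->
  is_derive x 1 (fun y => f (c + y)) a.
Proof.
move=> H.
have K := is_derive1D (is_derive_cst c x (1 : R)) (is_derive_id x (1 : R)).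
by apply: (is_derive_eq (is_derive1_chain H K)); rewrite add0r mulr1.
Qed.

Definition pos s : R := Num.max 0 s.

Lemma pos_ge0 s : 0 <= pos s.
Proof. by rewrite /pos le_max lexx. Qed.

Lemma pos_gt0 s : 0 < s -> pos s = s.
Proof. by move=> s0; rewrite /pos max_r// ltW. Qed.

Lemma pos_le0 s : s <= 0 -> pos s = 0.
Proof. by move=> s0; rewrite /pos max_l. Qed.

(** At 0 the difference quotient is bounded by a positive power of |h|, which is
    why one exponent is lost. *)
Lemma is_derive_posX n s : is_derive s 1 (fun x => pos x ^+ n.+2) (n.+2%:R * pos s ^+ n.+1).
Proof.
case: (ltgtP s 0) => [s0|s0|->].
- rewrite pos_le0 ?ltW// exprS mul0r mulr0.
  apply: (@near_eq_is_derive _ _ _ (cst 0)) => //.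
  near=> y; rewrite pos_le0 ?exprS ?mul0r//; near: y.
  by apply: filterS (lt_nbhsl s0) => y /ltW.
- rewrite pos_gt0//.
  apply: (@near_eq_is_derive _ _ _ (fun x => x ^+ n.+2)) => //.
    near=> y; rewrite pos_gt0//; near: y.
    exact: (lt_nbhsr s0).
  by have := is_derive1X n.+2 (is_derive_id s (1 : R)); rewrite mulr1.
- rewrite pos_le0// exprS mul0r mulr0.
  have cvg0 : h^-1 *: (pos (h *: 1 + 0) ^+ n.+2 - pos 0 ^+ n.+2) @[h --> 0^'] --> (0 : R).
    apply/cvgr0Pnorm_lt => d d0; near=> h.
    rewrite scaler1 addr0 (pos_le0 (lexx 0)) [0 ^+ _]exprS mul0r subr0.
    have h0 : h != 0 by near: h; exact: nbhs_dnbhs_neq.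
    have ph : `|pos h| <= `|h|.
      by rewrite /pos; case: (leP 0 h) => // _; rewrite normr0.
    rewrite normrM normfV normrX ltr_pdivrMl ?normr_gt0//.
    have hd : `|h| < d by near: h; apply: dnbhs0_lt.
    have h1 : `|h| < 1 by near: h; apply: dnbhs0_lt.
    apply: (@le_lt_trans _ _ (`|h| * `|h|)); last by rewrite ltr_pM2l ?normr_gt0.
    rewrite -expr2 (le_trans (lerXn2r _ _ _ ph)) ?nnegrE//.
    by rewrite ler_wiXn2l// ltW.
  apply: DeriveDef; first by apply/cvg_ex; exists 0.
  by apply/cvg_lim.
Unshelve. all: by end_near. Qed.

(** The cube makes the bump C^2, as a test function must be.  Writing e^2 - s^2
    instead of 1 - (s/e)^2 keeps divisions out of the derivatives. *)
Definition bump e s := pos (e ^+ 2 - s ^+ 2) ^+ 3.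
Definition bump1 e s := - 6 * s * pos (e ^+ 2 - s ^+ 2) ^+ 2.
Definition bump2 e s := - 6 * pos (e ^+ 2 - s ^+ 2) ^+ 2 + 24 * s ^+ 2 * pos (e ^+ 2 - s ^+ 2).

Let is_derive_arg e s : is_derive s 1 (fun x : R => e ^+ 2 - x ^+ 2) (- (2 * s)).
Proof.
apply: (is_derive_eq (is_derive1B (is_derive_cst (e ^+ 2) s 1) (is_derive1X 2 (is_derive_id s (1 : R))))).
by rewrite /= expr1 sub0r mulr1.
Qed.

Lemma is_derive_bump e s : is_derive s 1 (bump e) (bump1 e s).
Proof.
have := @is_derive1_chain _ (fun x => e ^+ 2 - x ^+ 2) _ _ _ (is_derive_posX 1 (e ^+ 2 - s ^+ 2)) (is_derive_arg e s).
by move/is_derive_eq; apply; rewrite /bump1; ring.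
Qed.

Lemma is_derive_bump1 e s : is_derive s 1 (bump1 e) (bump2 e s).
Proof.
have H := @is_derive1_chain _ (fun x => e ^+ 2 - x ^+ 2) _ _ _ (is_derive_posX 0 (e ^+ 2 - s ^+ 2)) (is_derive_arg e s).
have H2 : is_derive s 1 (fun x : R => - 6 * x) (- 6).
by apply: (is_derive_eq (is_derive1Ml (-6) (is_derive_id s (1 : R)))); rewrite mulr1.
have := is_deriveM H2 H.
move/is_derive_eq; apply; rewrite /bump2/GRing.scale/= /comp; ring.
Qed.

Lemma pos_cont : continuous pos.
Proof.
move=> x; rewrite /pos; apply: (@continuous_max _ _ (cst 0) id) => //.
exact: cvg_cst.
Qed.

Lemma bump_cont e : continuous (bump e).
Proof. by move=> x; apply/differentiable_continuous/derivable1_diffP; case: (is_derive_bump e x). Qed.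

Lemma bump1_cont e : continuous (bump1 e).
Proof. by move=> x; apply/differentiable_continuous/derivable1_diffP; case: (is_derive_bump1 e x). Qed.

Lemma bump2_cont e : continuous (bump2 e).
Proof.
have cX n : continuous (fun s : R => s ^+ n) by exact: exprn_continuous.
have carg : continuous (fun s : R => pos (e ^+ 2 - s ^+ 2)).
  move=> x; apply: (@continuous_comp _ _ _ (fun s : R => e ^+ 2 - s ^+ 2) pos); last exact: pos_cont.
  by apply: cvgB; [exact: cvg_cst|exact: cX].
have carg2 : continuous (fun s : R => pos (e ^+ 2 - s ^+ 2) ^+ 2).
  by move=> x; exact: (continuous_comp (carg x) (cX 2%N _)).
move=> x; rewrite /bump2.
apply: cvgD; apply: cvgM; [exact: cvg_cst|exact: carg2| |exact: carg].
by apply: cvgM; [exact: cvg_cst|exact: cX].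
Qed.

Lemma pos_arg_eq0 e s : 0 <= e -> e <= `|s| -> pos (e ^+ 2 - s ^+ 2) = 0.
Proof.
move=> e0 es; apply: pos_le0; rewrite subr_le0 -(real_normK (num_real s)).
by rewrite lerXn2r// nnegrE.
Qed.

Lemma bump_out e s : 0 <= e -> e <= `|s| -> bump e s = 0.
Proof. by move=> e0 es; rewrite /bump pos_arg_eq0// expr0n. Qed.

Lemma bump1_out e s : 0 <= e -> e <= `|s| -> bump1 e s = 0.
Proof. by move=> e0 es; rewrite /bump1 pos_arg_eq0// expr0n/= mulr0. Qed.

Lemma bump2_out e s : 0 <= e -> e <= `|s| -> bump2 e s = 0.
Proof. by move=> e0 es; rewrite /bump2 pos_arg_eq0// expr0n/= !mulr0 addr0. Qed.

Lemma bump_ge0 e s : 0 <= bump e s.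
Proof. by rewrite exprn_ge0// pos_ge0. Qed.

Lemma pos_arg_le1 e s : 0 <= e <= 1 -> pos (e ^+ 2 - s ^+ 2) <= 1.
Proof.
move=> /andP[e0 e1]; rewrite /pos ge_max ler01/= lerBlDr.
by rewrite (le_trans (exprn_ile1 2 e0 e1))// lerDl sqr_ge0.
Qed.

Lemma bump_le1 e s : 0 <= e <= 1 -> bump e s <= 1.
Proof. by move=> e01; rewrite exprn_ile1 ?pos_ge0 ?pos_arg_le1. Qed.

(** The constant 30 serves the bump and its two derivatives alike: for e <= 1 the
    largest of the three bounds is |bump2| <= 6 + 24. *)
Lemma bump_bound e s : 0 <= e <= 1 -> `|bump e s| <= 30.
Proof. by move=> e01; rewrite ger0_norm ?bump_ge0// (le_trans (bump_le1 _ e01))// ler1n. Qed.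

Lemma bump1_bound e s : 0 <= e <= 1 -> `|bump1 e s| <= 30.
Proof.
move=> e01; have [e0 e1] := andP e01.
have [es|se] := leP e `|s|; first by rewrite bump1_out// normr0.
have p0 := pos_ge0 (e ^+ 2 - s ^+ 2); have p1 := pos_arg_le1 s e01.
rewrite /bump1; set q := pos _ in p0 p1 *.
have q2 : q ^+ 2 <= 1 by rewrite exprn_ile1.
have q20 := sqr_ge0 q.
move: se; rewrite ltr_norml => /andP[se1 se2].
by rewrite ler_norml; apply/andP; split; nra.
Qed.

Lemma bump2_bound e s : 0 <= e <= 1 -> `|bump2 e s| <= 30.
Proof.
move=> e01; have [e0 e1] := andP e01.
have [es|se] := leP e `|s|; first by rewrite bump2_out// normr0.
have p0 := pos_ge0 (e ^+ 2 - s ^+ 2); have p1 := pos_arg_le1 s e01.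
rewrite /bump2; set q := pos _ in p0 p1 *.
have q2 : q ^+ 2 <= 1 by rewrite exprn_ile1.
have q20 := sqr_ge0 q.
have s2 : s ^+ 2 <= 1.
  by rewrite -(real_normK (num_real s)) exprn_ile1// ltW// (lt_le_trans se).
have s20 := sqr_ge0 s.
rewrite ler_norml; apply/andP; split; nra.
Qed.

Lemma is_derive_reflect (c s : R) (b b1 : R -> R) :
  (forall y : R, is_derive y 1 b (b1 y)) ->
  is_derive s 1 (fun y => b (c - y)) (- b1 (c - s)).
Proof.
move=> H; have K : is_derive s 1 (fun y : R => c - y) (-1).
  by apply: (is_derive_eq (is_derive1B (is_derive_cst c s 1) (is_derive_id s (1 : R)))); rewrite sub0r.
by apply: (is_derive_eq (is_derive1_chain (H _) K)); rewrite mulrN1.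
Qed.

(** Only the past matters in the time direction: this is what makes the top of
    a space-time region harmless for the maximum principle. *)
Lemma derive_left_max (g : R -> R) (a d e : R) : 0 < e -> is_derive a 1 g d ->
  (forall s, a - e < s -> s <= a -> g s <= g a) -> 0 <= d.
Proof.
move=> e0 [dg <-] gmax.
rewrite ['D_1 g a]cvg_at_leftE; last exact: dg.
apply: limr_ge.
  rewrite -(cvg_at_leftE (fun h => h^-1 *: ((g \o shift a) _ - g a))) //.
  apply: cvg_trans dg; apply: cvg_app.
  move=> A [r r0 Ar]; exists r => // x xe xgt0; apply: Ar => //.
  exact/ltr0_neq0.
near=> h; apply: mulr_le0.
  by rewrite invr_le0; apply: ltW; near: h; exists 1 => /=.
rewrite subr_le0 [_%:A]mulr1; apply: gmax => /=.
  suff : - e < h by lra.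
  near: h; exists e => //= h.
  by rewrite /ball_/= sub0r normrN ltr_norml => /andP[].
suff : h < 0 by lra.
by near: h; exists 1 => /=.
Unshelve. all: by end_near. Qed.

(** If g2 were positive, g1, which vanishes at the maximum, would be positive
    just to the right of it, so g would increase there. *)
Lemma second_derivative_max (g g1 : R -> R) (a g2 e : R) : 0 < e ->
  (forall s : R, `|s - a| < e -> is_derive s 1 g (g1 s)) -> is_derive a 1 g1 g2 ->
  (forall s, `|s - a| < e -> g s <= g a) -> g2 <= 0.
Proof.
move=> e0 dg dg1 gmax; rewrite leNgt; apply/negP => g20.
have ine s : s \in `]a - e, a + e[ -> `|s - a| < e.
  by rewrite in_itv/= => /andP[h1 h2]; rewrite ltr_norml; apply/andP; split; lra.
have g1a : g1 a = 0.
  have ae : `|a - a| < e by rewrite subrr normr0.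
  have [_ <-] := dg a ae.
  have aI : a \in `]a - e, a + e[ by rewrite in_itv/= ltrBlDr !ltrDl e0.
  have := @derive1_at_max _ g (a - e) (a + e) a.
  case=> //; first by rewrite lerD2l (le_trans _ (ltW e0))// oppr_le0 ltW.
    by move=> t /ine te; have [] := dg t te.
  by move=> t /ine; exact: gmax.
have [dg1a g1E] := dg1.
have : (\forall h \near 0^', 0 < h^-1 *: (g1 (h *: 1 + a) - g1 a)).
  by apply: cvgr_gt g20; rewrite -g1E; exact: dg1a.
move=> [d /= d0 Hd].
pose r : R := Num.min d e / 2.
have r0 : 0 < r by rewrite divr_gt0// lt_min d0.
have [rd re] : r < d /\ r < e.
  by rewrite /r; case: (leP d e) => de; split; lra.
have arI s : a <= s <= a + r -> `|s - a| < e.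
  by move=> /andP[s1 s2]; rewrite ger0_norm ?subr_ge0// ltrBlDl (le_lt_trans s2)// ltrD2l.
have [c cI] : exists2 c, c \in `]a, (a + r)[ & g (a + r) - g a = g1 c * (a + r - a).
  apply: MVT; first by rewrite ltrDl.
    by move=> x; rewrite in_itv/= => /andP[x1 x2]; apply/dg/arI; rewrite !ltW.
  apply: derivable_within_continuous => x; rewrite in_itv/= => xI.
  by have [] := dg x (arI _ xI).
move: cI; rewrite in_itv/= => /andP[c1 c2] gE.
have : 0 < (c - a)^-1 *: (g1 ((c - a) *: 1 + a) - g1 a).
  apply: Hd => /=; last by rewrite subr_eq0 gt_eqF.
  by rewrite sub0r normrN gtr0_norm ?subr_gt0// ltrBlDl (lt_trans c2)// ltrD2l.
rewrite scaler1 subrK g1a subr0 /GRing.scale/= pmulr_rgt0 ?invr_gt0 ?subr_gt0// => g1c.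
have : g (a + r) <= g a by apply/gmax/arI; rewrite lexx lerDl ltW.
by rewrite -subr_le0 gE addrAC subrr add0r leNgt mulr_gt0.
Qed.

Lemma continuous_translate (f : R -> R) a : continuous f -> continuous (fun s => f (s - a)).
Proof.
move=> cf s; apply: (@continuous_comp _ _ _ (fun y : R => y - a) f); last exact: cf.
by apply: cvgB; [exact: cvg_id|exact: cvg_cst].
Qed.

Lemma integral_translate (f : R -> R) a : continuous f -> (forall s, 0 <= f s) ->
  (\int[@lebesgue_measure R]_s (f (s - a))%:E = \int[@lebesgue_measure R]_s (f s)%:E)%E.
Proof.
move=> cf f0.
have dF x : is_derive x 1 (fun s : R => s - a) 1.
  by apply: (is_derive_eq (is_derive1B (is_derive_id x (1 : R)) (is_derive_cst a x 1))); rewrite subr0.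
have dFE : derive1 (fun s : R => s - a) = cst 1.
  by apply/funext => x; rewrite derive1E; have [_ ->] := dF x.
rewrite (@increasing_ge0_integration_by_substitutionT _ (fun s => s - a) f)//.
- by apply: eq_integral => x _ /=; rewrite dFE fctE /= mulr1.
- by move=> x y xy; rewrite ltrD2r.
- by rewrite dFE => x; exact: cvg_cst.
- by rewrite dFE; exact: is_cvg_cst.
- by rewrite dFE; exact: is_cvg_cst.
- exact: cvg_addrr_Ny.
- exact: cvg_addrr.
Qed.

Lemma integral_indic_segment (a b : R) : a <= b ->
  (\int[@lebesgue_measure R]_s (\1_`[a, b]%classic s)%:E = (b - a)%:E)%E.
Proof.
move=> ab; rewrite integral_indic// setIT.
transitivity (@lebesgue_measure R [set` `[a, b]]); first by [].
rewrite lebesgue_measure_itv/= lte_fin; case: ltP => // ba.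
by have -> : a = b; [apply/eqP; rewrite eq_le ab|rewrite subrr].
Qed.

(** Positivity comes from comparison with a constant on the half-size interval,
    finiteness from comparison with 1 on the support. *)
Lemma integral_bump e : 0 < e <= 1 -> exists2 I : R, 0 < I &
  forall a, (\int[@lebesgue_measure R]_s (bump e (s - a))%:E = I%:E)%E.
Proof.
move=> /andP[e0 e1]; have e01 : 0 <= e <= 1 by rewrite ltW.
set J := (\int[@lebesgue_measure R]_s (bump e s)%:E)%E.
have mb : measurable_fun [set: R] (EFin \o bump e).
  by apply/measurable_EFinP; apply: continuous_measurable_fun; exact: bump_cont.
have Jub : (J <= (e + e)%:E)%E.
  have -> : ((e + e)%:E = \int[@lebesgue_measure R]_s (\1_`[-e, e]%classic s)%:E)%E.
    by rewrite integral_indic_segment ?opprK//; lra.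
  apply: ge0_le_integral => //.
  - by move=> s _; rewrite lee_fin bump_ge0.
  - by apply/measurable_EFinP; exact: measurable_indic.
  - move=> s _; rewrite lee_fin indicE.
    case: (boolP (s \in _)) => [_|]; first exact: bump_le1.
    rewrite notin_setE/= in_itv/= => /negP h; rewrite bump_out ?(ltW e0)//.
    by rewrite leNgt; apply/negP => /ltW; rewrite ler_norml => /(negP h).
pose m := (3 / 4 * e ^+ 2) ^+ 3.
have m0 : 0 < m by rewrite exprn_gt0// mulr_gt0// ?exprn_gt0//; lra.
have Jlb : ((m * e)%:E <= J)%E.
  have -> : ((m * e)%:E = \int[@lebesgue_measure R]_s (m * \1_`[-e/2, e/2]%classic s)%:E)%E.
    under eq_integral do rewrite EFinM.
    rewrite ge0_integralZl_EFin// ?ltW//.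
      rewrite integral_indic_segment; last lra.
      by rewrite -EFinM; congr (_ * _)%:E; lra.
    by apply/measurable_EFinP; exact: measurable_indic.
  apply: ge0_le_integral => //.
  - by move=> s _; rewrite lee_fin mulr_ge0// ltW.
  - by apply/measurable_EFinP; apply: measurable_funM => //; exact: measurable_indic.
  - move=> s _; rewrite lee_fin indicE.
    case: (boolP (s \in _)) => [|_]; last by rewrite mulr0 bump_ge0.
    rewrite inE/= in_itv/= mulr1 => /andP[s1 s2].
    rewrite /m /bump lerXn2r ?nnegrE ?pos_ge0//; first by rewrite mulr_ge0 ?sqr_ge0//; lra.
    rewrite (@le_trans _ _ (e ^+ 2 - s ^+ 2))//; last by rewrite /pos le_max lexx orbT.
    by nra.
have Jfin : J \is a fin_num.
  by rewrite fin_numElt (lt_le_trans _ Jlb) ?ltNyr// (le_lt_trans Jub) ?ltry.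
exists (fine J).
  rewrite -lte_fin fineK//; apply: lt_le_trans Jlb; rewrite lte_fin mulr_gt0//.
move=> a; rewrite fineK// integral_translate//; first exact: bump_cont.
by move=> s; exact: bump_ge0.
Qed.

End bump.

(** * Integrals of products over the coordinates *)

Section product_integral.
Context {R : realType}.

(** Lebesgue measure on R^n is built by adding one coordinate at a time, so
    Tonelli peels off the first factor. *)
Lemma lebesgue_rV_prod n (g : 'I_n -> R -> R) (I : 'I_n -> R) :
  (forall i, measurable_fun [set: R] (g i)) -> (forall i s, 0 <= g i s) ->
  (forall i, (\int[@lebesgue_measure R]_s (g i s)%:E = (I i)%:E)%E) ->
  (\int[lebesgue_rV n]_x (\prod_(i < n) g i (x ord0 i))%:E = (\prod_(i < n) I i)%:E)%E.
Proof.
elim: n g I => [|n IH] g I mg g0 gI.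
  under eq_integral do rewrite big_ord0.
  by rewrite big_ord0/= integral_cst//= diracT mule1.
have mP m (k : 'I_m -> R -> R) : (forall i, measurable_fun [set: R] (k i)) ->
    measurable_fun [set: 'rV[R]_m] (fun x => \prod_(i < m) k i (x ord0 i)).
  move=> mk; apply: (@measurable_prod _ _ _ _ _ _ (fun i (x : 'rV[R]_m) => k i (x ord0 i))) => i _.
  by apply: measurableT_comp => //; exact: measurable_coord.
rewrite /= /lebesgue_cons ge0_integral_pushforward//; last 3 first.
- exact: measurable_cons_rV.
- by apply/measurable_EFinP; exact: mP.
- by move=> x _; rewrite lee_fin prodr_ge0.
rewrite preimage_setT.
have consE (p : R * 'rV[R]_n) : (\prod_(i < n.+1) g i (cons_rV p ord0 i) =
    g ord0 p.1 * \prod_(i < n) g (lift ord0 i) (p.2 ord0 i))%R.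
  rewrite big_ord_recl; congr (_ * _).
    have -> : ord0 = lshift n (ord0 : 'I_1) by exact/val_inj.
    by rewrite /cons_rV (@row_mxEl _ 1 1 n) mxE.
  apply: eq_bigr => i _.
  have -> : lift ord0 i = rshift 1 i by exact/val_inj.
  by rewrite /cons_rV (@row_mxEr _ 1 1 n).
under eq_integral do rewrite /= consE.
have mtail : measurable_fun [set: 'rV[R]_n]
    (fun y : 'rV[R]_n => \prod_(i < n) g (lift ord0 i) (y ord0 i)).
  by apply: (mP n (fun i => g (lift ord0 i))).
rewrite fubini_tonelli1//; last 2 first.
- apply/measurable_EFinP; apply: measurable_funM.
    exact: (measurableT_comp (mg ord0) measurable_fst).
  exact: (measurableT_comp mtail measurable_snd).
- by move=> x; rewrite lee_fin mulr_ge0// prodr_ge0.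
rewrite /fubini_F /=.
under eq_integral => x _.
  under eq_integral do rewrite EFinM.
  rewrite ge0_integralZl_EFin//; last 2 first.
  - by move=> y _; rewrite lee_fin prodr_ge0.
  - by apply/measurable_EFinP.
  rewrite (IH (fun i => g (lift ord0 i)) (fun i => I (lift ord0 i)))//.
  over.
rewrite ge0_integralZr//; last 3 first.
- by apply/measurable_EFinP; exact: (mg ord0).
- by move=> x _; rewrite lee_fin.
- rewrite lee_fin prodr_ge0// => i _; rewrite -lee_fin -gI.
  by apply: integral_ge0 => s _; rewrite lee_fin.
by rewrite gI big_ord_recl -EFinM.
Qed.
End product_integral.

(** * Product test functions *)

Section spacetime.
Context {R : realType} {N : nat}.
Local Notation X := ('rV[R]_N * R)%type.
Implicit Types (z w : X) (j k : option 'I_N) (nu : option 'I_N -> nat) (e : R).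

(** Space and time are treated alike by indexing the coordinates with
    [option 'I_N], where None stands for time. *)
Definition coord j z : R := if j is Some i then z.1 ord0 i else z.2.
Definition dir j : X := if j is Some i then dirx i else dirt N.

Lemma coord_dir j k (s : R) z : coord k (s *: dir j + z) = coord k z + s * (k == j)%:R.
Proof.
rewrite addrC; case: k j => [k|] [j|] //=; rewrite /dirx/dirt/= ?mxE.
- by rewrite eqxx.
- by [].
Qed.

Lemma coord_cont j : continuous (coord j).
Proof.
case: j => [i|] z /=; last exact: cvg_snd.
apply: (@continuous_comp _ _ _ fst (fun x : 'rV[R]_N => x ord0 i)); first exact: cvg_fst.
exact: coord_continuous.
Qed.

Lemma measurable_coordST j :
  measurable_fun [set: 'rV[R]_N * measurableTypeR R] (coord j).
Proof.
case: j => [i|] /=; last exact: measurable_snd.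
exact: (measurableT_comp (measurable_coord i) measurable_fst).
Qed.

Lemma prod_option (F : option 'I_N -> R) : \prod_j F j = F None * \prod_(i < N) F (Some i).
Proof.
rewrite (bigD1 None)//=; congr (_ * _).
rewrite (reindex_omap Some id)/=; last by case.
by apply: eq_bigl => i; rewrite eqxx.
Qed.

Lemma sum_option (F : option 'I_N -> R) : \sum_j F j = F None + \sum_(i < N) F (Some i).
Proof.
rewrite (bigD1 None)//=; congr (_ + _).
rewrite (reindex_omap Some id)/=; last by case.
by apply: eq_bigl => i; rewrite eqxx.
Qed.

(** Orders above 2 are never reached; they are given the value of order 2. *)
Definition bumpn (n : nat) e : R -> R :=
  match n with 0 => bump e | 1 => bump1 e | _ => bump2 e end.

Lemma bumpn_cont n e : continuous (bumpn n e).
Proof. by case: n => [|[|n]]; [exact: bump_cont|exact: bump1_cont|exact: bump2_cont]. Qed.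

Lemma bumpn_bound n e s : 0 <= e <= 1 -> `|bumpn n e s| <= 30.
Proof. by case: n => [|[|n]]; [exact: bump_bound|exact: bump1_bound|exact: bump2_bound]. Qed.

Lemma bumpn_out n e s : 0 <= e -> e <= `|s| -> bumpn n e s = 0.
Proof. by case: n => [|[|n]]; [exact: bump_out|exact: bump1_out|exact: bump2_out]. Qed.

Lemma is_derive_bumpn n e (s : R) : (n <= 1)%N -> is_derive s 1 (bumpn n e) (bumpn n.+1 e s).
Proof. by case: n => [|[|n]] n1; [exact: is_derive_bump|exact: is_derive_bump1|]. Qed.

Definition incr_order nu j : option 'I_N -> nat := fun i => (nu i + (i == j))%N.

(** The multi-index nu is an order of differentiation in w.  Keeping all the
    derivatives in one family reduces their continuity, support and bounds to
    a single statement. *)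
Definition zeta e nu z w : R := \prod_j bumpn (nu j) e (coord j w - coord j z).

Lemma zeta_cont e nu z : continuous (zeta e nu z).
Proof.
rewrite /zeta => w; elim: (index_enum _) => [|j s IH].
  by rewrite (_ : (fun _ => _) = cst 1); [exact: cvg_cst|apply/funext => y; rewrite big_nil].
rewrite (_ : (fun _ => _) = (fun y => bumpn (nu j) e (coord j y - coord j z) *
   \prod_(j <- s) bumpn (nu j) e (coord j y - coord j z))); last first.
  by apply/funext => y; rewrite big_cons.
apply: cvgM; last exact: IH.
apply: (@continuous_comp _ _ _ (fun y => coord j y - coord j z) (bumpn (nu j) e)); last exact: bumpn_cont.
by apply: cvgB; [exact: coord_cont|exact: cvg_cst].
Qed.

Lemma measurable_zeta e nu z :
  measurable_fun [set: 'rV[R]_N * measurableTypeR R] (zeta e nu z).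
Proof.
apply: (@measurable_prod _ _ _ _ _ _ (fun j (w : 'rV[R]_N * measurableTypeR R) =>
  bumpn (nu j) e (coord j w - coord j z))) => j _.
apply: (@measurableT_comp _ _ _ _ _ _ (fun s : measurableTypeR R => bumpn (nu j) e (s - coord j z)) _ (coord j)).
  apply: continuous_measurable_fun.
  by apply: (@continuous_translate R (bumpn (nu j) e)); exact: bumpn_cont.
exact: measurable_coordST.
Qed.

Lemma zeta_bound e nu z w : 0 <= e <= 1 -> `|zeta e nu z w| <= 30 ^+ N.+1.
Proof.
move=> e01; rewrite /zeta normr_prod.
rewrite -[in leRHS](card_ord N) -card_option -prodr_const.
by apply: ler_prod => j _; rewrite normr_ge0 bumpn_bound.
Qed.

Lemma zeta_out e nu z w j : 0 <= e -> e <= `|coord j w - coord j z| -> zeta e nu z w = 0.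
Proof. by move=> e0 ej; rewrite /zeta (bigD1 j)//= bumpn_out// mul0r. Qed.

Lemma zeta0_ge0 e z w : 0 <= zeta e (fun=> 0%N) z w.
Proof. by rewrite prodr_ge0// => j _; exact: bump_ge0. Qed.

Lemma prod_incr_order nu j e (f : option 'I_N -> R) :
  \prod_k bumpn (incr_order nu j k) e (f k) =
  bumpn (nu j).+1 e (f j) * \prod_(k | k != j) bumpn (nu k) e (f k).
Proof.
rewrite (bigD1 j)//= /incr_order eqxx addn1; congr (_ * _).
by apply: eq_bigr => k /negbTE ->; rewrite addn0.
Qed.

(** A directional derivative only sees the restriction to a line. *)
Lemma is_derive_line (f : X -> R) z v (d : R) :
  is_derive (0 : R) 1 (fun s => f (s *: v + z)) d -> is_derive z v f d.
Proof.
move=> [df <-].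
have E : (fun h : R => h^-1 *: (((fun s => f (s *: v + z)) \o shift 0) (h *: 1) - f (0 *: v + z))) =
         (fun h => h^-1 *: ((f \o shift z) (h *: v) - f z)).
  by apply/funext => h /=; rewrite addr0 scaler1 scale0r add0r.
by split; rewrite /derivable /derive -E.
Qed.

Lemma is_derive_zeta e nu z w j : (nu j <= 1)%N ->
  is_derive w (dir j) (zeta e nu z) (zeta e (incr_order nu j) z w).
Proof.
move=> nuj; apply: is_derive_line.
rewrite /zeta prod_incr_order mulrC.
rewrite (_ : (fun s => _) = (fun s => (\prod_(k | k != j) bumpn (nu k) e (coord k w - coord k z)) *
    bumpn (nu j) e (coord j w - coord j z + s))); last first.
  apply/funext => s; rewrite mulrC (bigD1 j)//= coord_dir eqxx mulr1 addrAC; congr (_ * _).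
  by apply: eq_bigr => k /negbTE kj; rewrite coord_dir kj mulr0 addr0.
apply: is_derive1Ml.
have H := is_derive_bumpn e (coord j w - coord j z + 0) nuj.
by apply: (is_derive_eq (is_derive1_shift H)); rewrite addr0.
Qed.

(** Moving the centre is, up to sign, the same as moving the argument: this is what
    turns the weak equation into a pointwise one. *)
Lemma is_derive_zeta_center e nu z w j (s : R) : (nu j <= 1)%N ->
  is_derive s 1 (fun s => zeta e nu (s *: dir j + z) w) (- zeta e (incr_order nu j) (s *: dir j + z) w).
Proof.
move=> nuj.
rewrite /zeta prod_incr_order -mulNr mulrC.
rewrite (_ : (fun s => _) = (fun s => (\prod_(k | k != j) bumpn (nu k) e (coord k w - coord k z)) *
    bumpn (nu j) e ((coord j w - coord j z) - s))); last first.
  apply/funext => y; rewrite mulrC (bigD1 j)//= coord_dir eqxx mulr1 opprD addrA; congr (_ * _).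
  by apply: eq_bigr => k /negbTE kj; rewrite coord_dir kj mulr0 addr0.
have -> : \prod_(k | k != j) bumpn (nu k) e (coord k w - coord k (s *: dir j + z)) =
    \prod_(k | k != j) bumpn (nu k) e (coord k w - coord k z).
  by apply: eq_bigr => k /negbTE kj; rewrite coord_dir kj mulr0 addr0.
apply: is_derive1Ml; rewrite coord_dir eqxx mulr1 opprD addrA.
by apply: is_derive_reflect => y; exact: is_derive_bumpn.
Qed.

Lemma derive_zeta e nu z j : (nu j <= 1)%N -> 'D_(dir j) (zeta e nu z) = zeta e (incr_order nu j) z.
Proof. by move=> nuj; apply/funext => w; have [] := is_derive_zeta e z w nuj. Qed.

Lemma compact_box z (r : R) : compact [set w : X | forall j, `|coord j w - coord j z| <= r].
Proof.
rewrite (_ : [set _ | _] = [set v : 'rV[R]_N | forall i, `[z.1 ord0 i - r, z.1 ord0 i + r]%classic (v ord0 i)]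
   `*` `[z.2 - r, z.2 + r]%classic).
  apply: compact_setX; last exact: segment_compact.
  by apply: (@rV_compact _ _ (fun i => `[z.1 ord0 i - r, z.1 ord0 i + r]%classic)) => i; exact: segment_compact.
apply/seteqP; split => [w /= H|w /= [H1 H2] [i|]/=].
- split; last by have := H None; rewrite /= in_itv/= ler_distl.
  by move=> i; have := H (Some i); rewrite /= in_itv/= ler_distl.
- by have := H1 i; rewrite /= in_itv/= ler_distl.
- by rewrite /= in_itv/= ler_distl in H2 *.
Qed.

Local Notation mu := (@spacetime_measure R N).
Local Notation Y := ('rV[R]_N * measurableTypeR R)%type.
Local Notation zero := (fun=> 0%N : nat).

Lemma measurable_QT (T : R) : measurable (QT N T : set Y).
Proof.
have -> : (QT N T : set Y) = snd @^-1` (`]0, T[ : set (measurableTypeR R)).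
  by apply/seteqP; split => z /=; rewrite in_itv.
by rewrite -[X in measurable X]setTI; exact: measurable_snd.
Qed.

Lemma open_QT (T : R) : open (QT N T).
Proof.
have -> : QT N T = snd @^-1` (`]0, T[ : set R).
  by apply/seteqP; split => z /=; rewrite in_itv.
by apply: open_comp; [move=> z _; exact: cvg_snd|exact: interval_open].
Qed.

Lemma integrable_mul_zeta (T e : R) nu z (g : X -> R) : 0 <= e <= 1 ->
  mu.-integrable (QT N T) (EFin \o g) ->
  mu.-integrable (QT N T) (EFin \o (fun w => g w * zeta e nu z w)).
Proof.
move=> e01 ig.
have mg : measurable_fun (QT N T : set Y) g by apply/measurable_EFinP; exact: measurable_int ig.
have iG := @integrableZl _ _ _ mu (QT N T) (measurable_QT T) (30 ^+ N.+1) _ ig.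
apply: (le_integrable (measurable_QT T) _ _ iG).
- apply/measurable_EFinP; apply: measurable_funM => //.
  by apply: measurable_funTS; exact: measurable_zeta.
- move=> w _ /=; rewrite lee_fin !normrM mulrC ler_wpM2r//.
  by rewrite (le_trans (zeta_bound nu z w e01))// ler_norm.
Qed.

Lemma zeta_nonzero_box e nu z w : 0 <= e -> zeta e nu z w != 0 ->
  forall j, `|coord j w - coord j z| <= e.
Proof.
move=> e0 Z0 j; rewrite leNgt; apply: contra Z0 => /ltW ej.
by apply/eqP; exact: (zeta_out _ e0 ej).
Qed.

Lemma zeta_C21 (T e : R) z : C21 T (zeta e zero z).
Proof.
have up nu : continuous_up_to (QT N T) (zeta e nu z).
  exists (zeta e nu z) => //; apply: continuous_subspaceT; exact: zeta_cont.
split.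
- by apply: continuous_subspaceT; exact: zeta_cont.
- split; first by move=> w _; have [] := @is_derive_zeta e zero z w None isT.
  by rewrite (@derive_zeta e zero z None).
- move=> i; split; first by move=> w _; have [] := @is_derive_zeta e zero z w (Some i) isT.
  by rewrite (@derive_zeta e zero z (Some i)).
- move=> i j; rewrite (@derive_zeta e zero z (Some i))//.
  have l1 : (incr_order zero (Some i) (Some j) <= 1)%N by rewrite /incr_order; case: eqP.
  split; first by move=> w _; have [] := is_derive_zeta e z w l1.
  by rewrite (@derive_zeta e _ z (Some j)).
Qed.

Lemma zeta_test (T e : R) z : 0 <= e -> e <= z.2 <= T - e -> test_function T (zeta e zero z).
Proof.
move=> e0 /andP[ez zT]; split; first exact: zeta_C21.
- apply: (subclosed_compact _ (@compact_box z e)); first exact: closed_closure.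
  have cB : closed [set w : X | forall j, `|coord j w - coord j z| <= e].
    by apply: compact_closed; [exact: norm_hausdorff|exact: (@compact_box z e)].
  rewrite [X in _ `<=` X]((closure_id _).1 cB); apply: closure_subset => w [_ /= Zw].
  exact: zeta_nonzero_box Zw.
- move=> x; apply: (@zeta_out _ _ _ _ None) => //=.
  by rewrite (le_trans _ (ler_norm _))// lerBrDr -lerBrDl// lerBrDr -lerBrDr.
Qed.

Lemma laplacian_zeta e z w :
  laplacian (zeta e zero z) w = \sum_(i < N) zeta e (incr_order (incr_order zero (Some i)) (Some i)) z w.
Proof.
apply: eq_bigr => i _; rewrite (@derive_zeta e zero z (Some i))//.
have l1 : (incr_order zero (Some i) (Some i) <= 1)%N by rewrite /incr_order eqxx.
by have [_] := is_derive_zeta e z w l1.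
Qed.

(** The mass is a product of one-dimensional integrals, each of which is
    invariant under translation; so it is the same for all centres whose bump is
    supported in the strip. *)
Lemma zeta_mass e : 0 < e <= 1 -> exists2 c : R, 0 < c &
  forall T z, e <= z.2 <= T - e -> (\int[mu]_(w in QT N T) (zeta e zero z w)%:E = c%:E)%E.
Proof.
move=> e01; have [I I0 IE] := integral_bump e01.
have [e0 e1] := andP e01.
exists (I ^+ N.+1); first by rewrite exprn_gt0.
move=> T z /andP[ez zT].
transitivity (\int[mu]_w (zeta e zero z w)%:E)%E.
  rewrite [in LHS]integral_mkcond; apply: eq_integral => w _ /=.
  rewrite patchE; case: ifPn => //; rewrite notin_setE /QT/= => wQ.
  rewrite (@zeta_out e zero z w None) ?(ltW e0)//=.
  rewrite leNgt; apply: contra_notN wQ; rewrite ltr_distl => /andP[w1 w2].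
  by apply/andP; split; lra.
rewrite fubini_tonelli1//; last 2 first.
- by apply/measurable_EFinP; exact: measurable_zeta.
- by move=> w; rewrite lee_fin zeta0_ge0.
have mg i : measurable_fun [set: R] (fun s : R => bump e (s - z.1 ord0 i)).
  apply: continuous_measurable_fun.
  by apply: (@continuous_translate R (bump e)); exact: bump_cont.
rewrite /fubini_F.
under eq_integral => x _.
  under eq_integral do rewrite /zeta prod_option/= mulrC EFinM.
  rewrite ge0_integralZl_EFin//; last 3 first.
  - by move=> y _; rewrite lee_fin bump_ge0.
  - apply/measurable_EFinP; apply: continuous_measurable_fun.
    by apply: (@continuous_translate R (bump e)); exact: bump_cont.
  - by rewrite prodr_ge0// => i _; exact: bump_ge0.
  rewrite IE.
  over.
rewrite ge0_integralZr//; last 3 first.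
- apply/measurable_EFinP.
  apply: (@measurable_prod _ _ _ _ _ _ (fun i (x : 'rV[R]_N) => bump e (x ord0 i - z.1 ord0 i))) => i _.
  exact: (measurableT_comp (mg i) (measurable_coord i)).
- by move=> x _; rewrite lee_fin prodr_ge0// => i _; exact: bump_ge0.
- by rewrite lee_fin ltW.
rewrite (@lebesgue_rV_prod _ N (fun i s => bump e (s - z.1 ord0 i)) (fun=> I))//.
  by rewrite prodr_const card_ord -EFinM exprSr.
by move=> i s; exact: bump_ge0.
Qed.

Lemma integrable_zeta T e (c : R) z : 0 <= e <= 1 ->
  (\int[mu]_(w in QT N T) (zeta e zero z w)%:E = c%:E)%E ->
  mu.-integrable (QT N T) (EFin \o zeta e zero z).
Proof.
move=> e01 cE; apply/integrableP; split.
  by apply/measurable_EFinP; apply: measurable_funTS; exact: measurable_zeta.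
under eq_integral do rewrite /= ger0_norm ?zeta0_ge0//.
by rewrite cE ltry.
Qed.

Lemma coordB j z w : coord j (w - z) = coord j w - coord j z.
Proof. by case: j => [i|] //=; rewrite !mxE. Qed.

Lemma zeta_translate e nu z w : zeta e nu z w = zeta e nu 0 (w - z).
Proof.
apply: eq_bigr => j _; rewrite coordB.
have -> : coord j (0 : X) = 0 by case: j => [i|] //=; rewrite mxE.
by rewrite subr0.
Qed.

(** Uniformity in w: the supports for all nearby centres lie in one compact box,
    over which joint continuity is uniform. *)
Lemma zeta_near_center e nu z0 (a : R) : 0 <= e -> 0 < a ->
  \forall z \near z0, forall w, `|zeta e nu z w - zeta e nu z0 w| <= a.
Proof.
move=> e0 a0.
have /compact_near_coveringP cB := @compact_box z0 (e + 1).
have nB : \forall z \near z0, [set w | forall j, `|coord j w - coord j z0| <= e + 1] `<=`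
    (fun w => `|zeta e nu z w - zeta e nu z0 w| < a).
  apply: (cB X (nbhs z0) (fun z w => `|zeta e nu z w - zeta e nu z0 w| < a)) => w _.
  pose g (q : X * X) := zeta e nu q.2 q.1 - zeta e nu z0 q.1.
  have c1 : continuous (fun q : X * X => zeta e nu 0 (q.1 - q.2)).
    move=> q; apply: (@continuous_comp _ _ _ (fun q : X * X => q.1 - q.2) (zeta e nu 0)); last exact: zeta_cont.
    by apply: cvgB; [exact: cvg_fst|exact: cvg_snd].
  have c2 : continuous (fun q : X * X => zeta e nu z0 q.1).
    by move=> q; apply: (@continuous_comp _ _ _ fst (zeta e nu z0)); [exact: cvg_fst|exact: zeta_cont].
  have cg : continuous g.
    have -> : g = (fun q : X * X => zeta e nu 0 (q.1 - q.2) - zeta e nu z0 q.1).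
      by apply/funext => q; rewrite /g zeta_translate.
    by move=> q; apply: cvgB; [exact: c1|exact: c2].
  have := cg (w, z0); rewrite /continuous_at {2}/g subrr => /cvgr0_norm_lt /(_ _ a0).
  done.
have n1 : \forall z \near z0, forall j, `|coord j z - coord j z0| < 1.
  apply: (@filter_forall X (option 'I_N) (fun j z => `|coord j z - coord j z0| < 1) (nbhs z0) _) => j.
  have /cvgrPdist_lt /(_ _ ltr01) := @coord_cont j z0.
  by apply: filterS => z; rewrite distrC.
near=> z => w.
have [wB|] := pselect (forall j, `|coord j w - coord j z0| <= e + 1).
  by apply: ltW; move: w wB; exact: (near nB z).
move=> /existsNP[j /negP]; rewrite -ltNge => ej.
have zj : `|coord j z - coord j z0| < 1 by move: j {ej}; exact: (near n1 z).
have tri : `|coord j w - coord j z0| <= `|coord j w - coord j z| + `|coord j z - coord j z0|.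
  exact: ler_distD.
rewrite (@zeta_out e nu z w j)//; last lra.
rewrite (@zeta_out e nu z0 w j)//; last lra.
by rewrite subrr normr0 ltW.
Unshelve. all: by end_near. Qed.

(** * Averages of a solution *)

Section smoothing.
Variables (T p k : R) (h u : X -> R).
Hypothesis usol : heat_solution T p h k u.
Variable e : R.
Hypothesis e01 : 0 < e <= 1.

Let e01' : 0 <= e <= 1. Proof. by case/andP: e01 => /ltW ->. Qed.

Definition mollify nu z : R := \int[mu]_(w in QT N T) (u w * zeta e nu z w).

Definition absorption z : R :=
  \int[mu]_(w in QT N T) (h w * u w `^ p * zeta e zero z w).

Let iu : mu.-integrable (QT N T) (EFin \o u). Proof. by case: usol. Qed.
Let ihu : mu.-integrable (QT N T) (fun z => (h z * u z `^ p)%:E). Proof. by case: usol. Qed.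

Let iZ nu z : mu.-integrable (QT N T) (EFin \o (fun w => u w * zeta e nu z w)).
Proof. exact: integrable_mul_zeta. Qed.

Let ihZ z : mu.-integrable (QT N T) (EFin \o (fun w => h w * u w `^ p * zeta e zero z w)).
Proof. exact: (@integrable_mul_zeta _ _ _ _ (fun w => h w * u w `^ p)). Qed.

(** The weak formulation tested with zeta centred at z.  Both second-order terms
    and the time derivative appear as averages of u against derivatives of
    zeta in w; the datum at (0, 0) disappears because the support of zeta stays
    in the open strip. *)
Lemma weak_identity z : e < z.2 < T - e ->
  - mollify (incr_order zero None) z - \sum_(i < N) mollify (incr_order (incr_order zero (Some i)) (Some i)) z
  + absorption z = 0.
Proof.
move=> /andP[ez zT]; have [e0 e1] := andP e01'.
have tZ : test_function T (zeta e zero z) by apply: zeta_test; rewrite ?e0// !ltW.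
have [_ _ _ _ /(_ _ tZ)] := usol.
rewrite (@zeta_out e zero z (0, 0) None)//; last first.
  by rewrite /= sub0r normrN (le_trans (ltW ez))// ler_norm.
rewrite mulr0 => /(congr1 fine) W.
have mQ := measurable_QT T.
have iS : mu.-integrable (QT N T) (EFin \o (fun w => \sum_(i < N) u w * zeta e (incr_order (incr_order zero (Some i)) (Some i)) z w)).
  have := @integrable_sum _ _ _ mu _ mQ _ (index_enum 'I_N) xpredT (fun i w => (u w * zeta e (incr_order (incr_order zero (Some i)) (Some i)) z w)%:E).
  move=> /(_ (fun i _ => iZ _ z)); congr (is_true (integrable _ _ _)).
  by apply/funext => w; rewrite /= sumEFin.
have SE : \int[mu]_(w in QT N T) (\sum_(i < N) u w * zeta e (incr_order (incr_order zero (Some i)) (Some i)) z w)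
   = \sum_(i < N) mollify (incr_order (incr_order zero (Some i)) (Some i)) z.
  rewrite /Rintegral; under eq_integral do rewrite -sumEFin.
  rewrite integral_sum//; last by move=> i; exact: iZ.
  transitivity (fine (\sum_(i < N) mollify (incr_order (incr_order zero (Some i)) (Some i)) z)%:E); last by [].
  congr fine; rewrite -sumEFin; apply: eq_bigr => i _.
  by rewrite fineK//; apply: integrable_fin_num => //; exact: iZ.
have iN : mu.-integrable (QT N T) (EFin \o (fun w => -1 * (u w * zeta e (incr_order zero None) z w))).
  by have := @integrableZl _ _ _ mu _ mQ (-1) _ (iZ (incr_order zero None) z).
have iB := integrableB mQ iN iS.
transitivity (\int[mu]_(w in QT N T) (- u w * 'D_(dirt N) (zeta e zero z) w
  - u w * laplacian (zeta e zero z) w + h w * u w `^ p * zeta e zero z w)); last exact: W.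
rewrite -SE /absorption -mulN1r /mollify -RintegralZl// -RintegralB// -RintegralD//.
apply: eq_Rintegral => w _.
have -> : 'D_(dirt N) (zeta e zero z) w = zeta e (incr_order zero None) z w.
  by have [_] := @is_derive_zeta e zero z w None isT.
rewrite laplacian_zeta mulN1r mulNr.
by rewrite mulr_sumr.
Qed.

(** Differentiation under the integral sign, with a multiple of |u| as dominating
    function. *)
Lemma is_derive_mollify nu z j (s : R) : (nu j <= 1)%N ->
  is_derive s 1 (fun s => mollify nu (s *: dir j + z)) (- mollify (incr_order nu j) (s *: dir j + z)).
Proof.
move=> nuj.
pose f (s : R) w := u w * zeta e nu (s *: dir j + z) w.
have df (r : R) w : is_derive r 1 (f ^~ w) (- (u w * zeta e (incr_order nu j) (r *: dir j + z) w)).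
  by apply: (is_derive_eq (is_derive1Ml (u w) (is_derive_zeta_center e z w r nuj))); rewrite mulrN.
have mQ := measurable_QT T.
have d1E r w : partial1of2 f r w = - (u w * zeta e (incr_order nu j) (r *: dir j + z) w).
  by rewrite partial1of2E; have [_ ->] := df r w.
pose G w := 30 ^+ N.+1 * `|u w|.
have G0 w : 0 <= G w by rewrite mulr_ge0// exprn_ge0.
have iG : mu.-integrable (QT N T) (EFin \o G).
  by have := @integrableZl _ _ _ mu _ mQ (30 ^+ N.+1) _ (integrable_abse iu).
have sI : `]s - 1, s + 1[%classic s by rewrite /= in_itv/=; apply/andP; split; lra.
have intf r : `]s - 1, s + 1[%classic r -> mu.-integrable (QT N T) (EFin \o f r).
  by move=> _; exact: iZ.
have derf r w : `]s - 1, s + 1[%classic r -> QT N T w -> derivable (f ^~ w) r 1.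
  by move=> _ _; have [] := df r w.
have Gub r w : `]s - 1, s + 1[%classic r -> QT N T w -> `|partial1of2 f r w| <= G w.
  move=> _ _; rewrite d1E normrN normrM mulrC ler_wpM2r//.
  exact: zeta_bound.
split.
  exact: (derivable_under_integral mQ sI intf derf G0 iG Gub).
rewrite -derive1E (differentiation_under_integral mQ sI intf derf G0 iG Gub).
rewrite -mulN1r /mollify -RintegralZl//.
by apply: eq_Rintegral => w _; rewrite d1E mulN1r.
Qed.

Lemma absorption_ge (c m : R) z :
  (\int[mu]_(w in QT N T) (zeta e zero z w)%:E = c%:E)%E ->
  (forall w, QT N T w -> (forall j, `|coord j w - coord j z| <= e) -> m <= h w * u w `^ p) ->
  m * c <= absorption z.
Proof.
move=> cE mle; have mQ := measurable_QT T; have [e0 e1] := andP e01'.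
have iZe : mu.-integrable (QT N T) (EFin \o zeta e zero z).
  exact: (integrable_zeta e01' cE).
have -> : c = \int[mu]_(w in QT N T) zeta e zero z w by rewrite /Rintegral cE.
rewrite -RintegralZl//; apply: le_Rintegral => //.
  by have := @integrableZl _ _ _ mu _ mQ m _ iZe.
move=> w Qw; have [->|Z0] := eqVneq (zeta e zero z w) 0; first by rewrite !mulr0.
by rewrite ler_wpM2r ?zeta0_ge0// mle//; exact: (zeta_nonzero_box e0 Z0).
Qed.

Lemma mollify_near (c a : R) z :
  (\int[mu]_(w in QT N T) (zeta e zero z w)%:E = c%:E)%E ->
  (forall w, QT N T w -> (forall j, `|coord j w - coord j z| <= e) -> `|u w - u z| <= a) ->
  `|mollify zero z - u z * c| <= a * c.
Proof.
move=> cE mle; have mQ := measurable_QT T; have [e0 e1] := andP e01'.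
have iZe : mu.-integrable (QT N T) (EFin \o zeta e zero z).
  exact: (integrable_zeta e01' cE).
have -> : c = \int[mu]_(w in QT N T) zeta e zero z w by rewrite /Rintegral cE.
rewrite ler_distl -mulrBl -mulrDl -!RintegralZl//; apply/andP; split; apply: le_Rintegral => //.
- by have := @integrableZl _ _ _ mu _ mQ (u z - a) _ iZe.
- move=> w Qw; have [->|Z0] := eqVneq (zeta e zero z w) 0; first by rewrite !mulr0.
  rewrite ler_wpM2r ?zeta0_ge0//.
  by have := mle w Qw (zeta_nonzero_box e0 Z0); rewrite ler_distl => /andP[].
- by have := @integrableZl _ _ _ mu _ mQ (u z + a) _ iZe.
- move=> w Qw; have [->|Z0] := eqVneq (zeta e zero z w) 0; first by rewrite !mulr0.
  rewrite ler_wpM2r ?zeta0_ge0//.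
  by have := mle w Qw (zeta_nonzero_box e0 Z0); rewrite ler_distl => /andP[].
Qed.

(** Here zeta varies uniformly with its centre, and u is integrable. *)
Lemma mollify_cont nu : continuous (mollify nu).
Proof.
move=> z0; apply/cvgrPdist_le => a a0; have mQ := measurable_QT T; have [e0 e1] := andP e01'.
pose L := \int[mu]_(w in QT N T) `|u w|.
have iabs := integrable_abse iu.
have L0 : 0 <= L by apply: Rintegral_ge0.
have aL : 0 < a / (L + 1) by rewrite divr_gt0// ltr_wpDl.
apply: filterS (zeta_near_center nu z0 e0 aL) => z Hz.
rewrite /mollify -RintegralB//.
have iB := integrableB mQ (iZ nu z0) (iZ nu z).
apply: (le_trans (le_normr_Rintegral mQ iB)).
apply: (@le_trans _ _ (\int[mu]_(w in QT N T) (a / (L + 1) * `|u w|))).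
  apply: le_Rintegral => //.
  - by have := integrable_abse iB.
  - by have := @integrableZl _ _ _ mu _ mQ (a / (L + 1)) _ iabs.
  - move=> w _; rewrite -mulrBr normrM mulrC ler_wpM2r// distrC; exact: Hz.
rewrite RintegralZl// -/L mulrAC ler_pdivrMr ?ltr_wpDl//.
by rewrite ler_pM2l// lerDl.
Qed.

End smoothing.

(** * Neighbourhoods and uniform scales *)

Lemma near_strict_box (a z : X) (r : R) : (forall j, `|coord j z - coord j a| < r) ->
  \forall w \near z, forall j, `|coord j w - coord j a| < r.
Proof.
move=> zr.
apply: (@filter_forall X (option 'I_N) (fun j w => `|coord j w - coord j a| < r) (nbhs z) _) => j.
have rz : 0 < r - `|coord j z - coord j a| by rewrite subr_gt0.
have /cvgrPdist_lt /(_ _ rz) := @coord_cont j z.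
apply: filterS => w; rewrite distrC => wz.
have tri : `|coord j w - coord j a| <= `|coord j w - coord j z| + `|coord j z - coord j a| by exact: ler_distD.
lra.
Qed.

Lemma near_box z (r : R) : 0 < r ->
  \forall w \near z, forall j, `|coord j w - coord j z| < r.
Proof. by move=> r0; apply: near_strict_box => j; rewrite subrr normr0. Qed.

Lemma nbhs_box z (P : set X) : nbhs z P ->
  exists2 r : R, 0 < r & forall w, (forall j, `|coord j w - coord j z| < r) -> P w.
Proof.
move=> /nbhs_ballP[r /= r0 rP]; exists r => // w wr; apply: rP; split.
  split=> // a i; rewrite (ord1 a) /ball/= distrC; exact: (wr (Some i)).
by rewrite /ball/= distrC; exact: (wr None).
Qed.

Lemma coord_dir_near j i (s r : R) z : `|s| <= r -> `|coord i (s *: dir j + z) - coord i z| <= r.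
Proof.
move=> sr; rewrite coord_dir addrAC subrr add0r.
case: (i == j); rewrite ?mulr1// mulr0 normr0.
exact: le_trans sr.
Qed.

Lemma near_inner_box (a z : X) (r : R) : (forall j, `|coord j z - coord j a| < r) ->
  exists2 d : R, 0 < d & forall j (s : R), `|s| < d ->
    forall i, `|coord i (s *: dir j + z) - coord i a| < r.
Proof.
move=> /near_strict_box /nbhs_box[d d0 H].
exists d => // j s sd i; apply: H => l.
exact: le_lt_trans (coord_dir_near _ _ _ (lexx _)) sd.
Qed.

Lemma QT_punctured (T : R) : QT N T `<=` punctured_strip N T.
Proof.
move=> z Qz; split; first exact: subset_closure.
by move=> /= z0; move: Qz; rewrite z0 /QT/= ltxx.
Qed.

Lemma solution_continuous (T p k : R) h (u : X -> R) z :
  heat_solution T p h k u -> QT N T z -> {for z, continuous u}.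
Proof.
move=> [cu _ _ _ _] Qz.
have := continuous_subspaceW (@QT_punctured T) cu.
by rewrite continuous_open_subspace; [apply; rewrite inE|exact: open_QT].
Qed.

(** A Lebesgue-number argument: one radius serves all the centres in K. *)
Lemma uniform_scale (K O : set X) (u : X -> R) (a : R) : compact K -> open O -> K `<=` O ->
  (forall z, O z -> {for z, continuous u}) -> 0 < a ->
  exists2 e : R, 0 < e <= 1 & forall z, K z -> forall w,
    (forall j, `|coord j w - coord j z| <= e) -> O w /\ `|u w - u z| <= a.
Proof.
move=> /compact_near_coveringP cK oO KO cu a0.
have nK : \forall e \near (0 : R)^'+, K `<=` (fun z => forall w,
    (forall j, `|coord j w - coord j z| <= e) -> O w /\ `|u w - u z| <= a).
  apply: (cK R (0 : R)^'+ (fun e z => forall w,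
    (forall j, `|coord j w - coord j z| <= e) -> O w /\ `|u w - u z| <= a)) => x Kx.
  have a2 : 0 < a / 2 by rewrite divr_gt0.
  have nO : nbhs x O by apply: open_nbhs_nbhs; split => //; exact: KO.
  have /cvgrPdist_lt /(_ _ a2) nu := cu x (KO _ Kx).
  have [r r0 Hr] := nbhs_box (filterI nO nu).
  have r2 : 0 < r / 2 by rewrite divr_gt0.
  exists ([set x' | forall j, `|coord j x' - coord j x| < r / 2], [set e | e < r / 2]) => /=.
    by split; [exact: near_box|exact: nbhs_right_lt].
  move=> [x' e]/= [x'r er] w we.
  have [|_ ux'] := Hr x'; first by move=> j; rewrite (lt_trans (x'r j))// gtr_pMr// invf_lt1 ?ltr1n.
  have [j|Ow uw] := Hr w.
    have tri : `|coord j w - coord j x| <= `|coord j w - coord j x'| + `|coord j x' - coord j x| by exact: ler_distD.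
    have := we j; have := x'r j; lra.
  split=> //.
  have tri : `|u w - u x'| <= `|u w - u x| + `|u x - u x'| by exact: ler_distD.
  move: uw ux'; rewrite /= (distrC (u x) (u w)); lra.
have [e [eK [e0 e1]]] : exists e : R, K `<=` (fun z => forall w,
    (forall j, `|coord j w - coord j z| <= e) -> O w /\ `|u w - u z| <= a) /\ (0 < e /\ e <= 1).
  apply: (@filter_ex _ (0 : R)^'+).
  by apply: filterI => //; apply: filterI; [exact: nbhs_right_gt|exact: nbhs_right_le].
by exists e; [rewrite e0|exact: eK].
Qed.

(** * Comparison principle *)

Section comparison.
Variables (T p k : R) (h u : X -> R).
Hypothesis usol : heat_solution T p h k u.
Hypothesis p0 : 0 <= p.
Variables (K O : set X) (c0 : R).
Hypotheses (cK : compact K) (oO : open O) (KO : K `<=` O) (OQ : O `<=` QT N T).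
Hypotheses (c00 : 0 <= c0) (hc0 : forall w, O w -> c0 <= h w).
Variables v v1 v2 : option 'I_N -> R -> R.
(** Separable barriers suffice, and their partial derivatives are derivatives of
    functions of one variable. *)
Definition separable z : R := \sum_j v j (coord j z).
Local Notation V := separable.
Hypothesis V1 : forall z, K z -> 1 <= V z.
Hypothesis dv : forall z, K z -> forall j, exists2 r : R, 0 < r &
  forall s : R, `|s - coord j z| < r -> is_derive s 1 (v j) (v1 j s).
Hypothesis dv1 : forall z, K z -> forall i, is_derive (coord (Some i) z) 1 (v1 (Some i)) (v2 (Some i) (coord (Some i) z)).
Hypothesis bdry_or_super : forall z, K z -> u z + 1 <= V z \/
  exists r : R, [/\ 0 < r,
    forall i (s : R), `|s| < r -> K (s *: dir (Some i) + z),
    forall s : R, - r < s -> s <= 0 -> K (s *: dir None + z) &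
    0 < v1 None (coord None z) - \sum_(i < N) v2 (Some i) (coord (Some i) z) + c0 * (V z - 2^-1) `^ p].

Lemma separable_dir j (s : R) z :
  V (s *: dir j + z) = v j (coord j z + s) + \sum_(i | i != j) v i (coord i z).
Proof.
rewrite /V (bigD1 j)//= coord_dir eqxx mulr1; congr (_ + _).
by apply: eq_bigr => i /negbTE ij; rewrite coord_dir ij mulr0 addr0.
Qed.

Lemma separable_cont z : K z -> {for z, continuous V}.
Proof.
move=> Kz.
suff : forall s, (fun y => \sum_(j <- s) v j (coord j y)) @ z --> \sum_(j <- s) v j (coord j z) by exact.
elim=> [|j s IH].
  by rewrite (_ : (fun _ => _) = cst 0) ?big_nil; [exact: cvg_cst|apply/funext => y; rewrite big_nil].
rewrite (_ : (fun _ => _) = (fun y => v j (coord j y) + \sum_(j <- s) v j (coord j y))); last first.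
  by apply/funext => y; rewrite big_cons.
rewrite big_cons; apply: cvgD; last exact: IH.
apply: (@continuous_comp _ _ _ (coord j) (v j)); first exact: coord_cont.
have [r r0 H] := dv Kz j.
have [|D _] := H (coord j z); first by rewrite subrr normr0.
exact/differentiable_continuous/derivable1_diffP.
Qed.

Lemma is_derive_separable_dir z j (s a : R) : is_derive (coord j z + s) 1 (v j) a ->
  is_derive s 1 (fun s => V (s *: dir j + z)) a.
Proof.
move=> H.
rewrite (_ : (fun s => _) = (fun s => v j (coord j z + s) + \sum_(i | i != j) v i (coord i z))); last first.
  by apply/funext => y; rewrite separable_dir.
by apply: (is_derive_eq (is_derive1D (is_derive1_shift H) (is_derive_cst _ s (1 : R)))); rewrite addr0.
Qed.

(** Let F be the average of u minus c V, where c is the mass of zeta, and z0 a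
    maximum point of F on K.  The average is within c / 4 of c u; so if
    F z0 > 0, the alternative u + 1 <= V fails at z0, and K contains the segments around
    z0 that the maximum conditions require.  These give
    c (V_t - Laplacian V) + absorption <= 0, while u > V - 1/2 on the support of
    zeta makes the absorption at least c c0 (V - 1/2)^p: a contradiction. *)
Lemma comparison z : K z -> u z <= V z + 1.
Proof.
move=> Kz.
have cu y : O y -> {for y, continuous u}.
  by move=> Oy; apply: (solution_continuous usol); exact: OQ.
have q0 : 0 < (4^-1 : R) by rewrite invr_gt0.
have [e e01 He] := uniform_scale cK oO KO cu q0.
have [e0 e1] := andP e01.
have inQ y : K y -> e < y.2 < T - e.
  move=> Ky; have Hs (s : R) : `|s| <= e -> 0 < s + y.2 < T.
    move=> se; have [|Os _] := He y Ky (s *: dir None + y).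
      by move=> j; exact: coord_dir_near.
    have E : (s *: dir None + y).2 = s + y.2.
      by rewrite -[LHS]/(coord None _) coord_dir eqxx mulr1 addrC.
    by move: (OQ Os); rewrite /QT/mkset E.
  have /andP[a1 a2] : 0 < e + y.2 < T by apply: Hs; rewrite gtr0_norm.
  have /andP[b1 b2] : 0 < - e + y.2 < T by apply: Hs; rewrite normrN gtr0_norm.
  by apply/andP; split; lra.
have [c cgt0 mass] := zeta_mass e01.
have massK y : K y -> (\int[mu]_(w in QT N T) (zeta e zero y w)%:E = c%:E)%E.
  by move=> /inQ /andP[y1 y2]; apply: mass; rewrite !ltW.
pose S nu y := mollify T u e nu y.
have Snear y : K y -> `|S zero y - u y * c| <= 4^-1 * c.
  move=> Ky; apply: (mollify_near usol e01 (massK y Ky)) => w _ wy.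
  by have [] := He y Ky w wy.
pose F y := S zero y - c * V y.
have cF : {within K, continuous F}.
  apply: continuous_in_subspaceT => y /set_mem Ky.
  apply: cvgB; first exact: (mollify_cont usol e01).
  by apply: cvgM; [exact: cvg_cst|exact: separable_cont].
have [z0 /set_mem Kz0 Fmax] : exists2 z0, z0 \in K & forall t, t \in K -> F t <= F z0.
  by apply: compact_EVT_max => //; exists z.
have {}Fmax y : K y -> F y <= F z0 by move=> Ky; apply: Fmax; rewrite inE.
suff Fle : F z0 <= 0.
  have FS : S zero z - c * V z <= 0 by apply: le_trans Fle; exact: Fmax.
  have := Snear z Kz; rewrite ler_distl => /andP[S1 _].
  rewrite -(ler_pM2r cgt0); lra.
rewrite leNgt; apply/negP => F0.
have := Snear z0 Kz0; rewrite ler_distl => /andP[S1 S2].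
have SV : c * V z0 < S zero z0 by rewrite -subr_gt0.
have uV : V z0 - 4^-1 < u z0 by rewrite -(ltr_pM2r cgt0); lra.
have [ub|[r [r0 Kx Kt super]]] := bdry_or_super Kz0; first lra.
pose g j (s : R) := S zero (s *: dir j + z0) - c * V (s *: dir j + z0).
have Sdir nu j (s : R) : (nu j <= 1)%N ->
    is_derive s 1 (fun s => S nu (s *: dir j + z0)) (- S (incr_order nu j) (s *: dir j + z0)).
  exact: (is_derive_mollify usol e01).
have g0 j : g j 0 = F z0 by rewrite /g scale0r add0r.
have dir0 j : 0 *: dir j + z0 = z0 by rewrite scale0r add0r.
have dg j (s : R) a : is_derive (coord j z0 + s) 1 (v j) a ->
    is_derive s 1 (g j) (- S (incr_order zero j) (s *: dir j + z0) - c * a).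
  move=> /is_derive_separable_dir dV.
  exact: is_derive1B (Sdir zero j s isT) (is_derive1Ml c dV).
have space i : S (incr_order (incr_order zero (Some i)) (Some i)) z0 <= c * v2 (Some i) (coord (Some i) z0).
  pose j := Some i.
  have [r' r'0 dvj] := dv Kz0 j.
  rewrite -subr_le0.
  pose m := Num.min r r'.
  have m0 : 0 < m by rewrite lt_min r0.
  pose g1 (s : R) := - S (incr_order zero j) (s *: dir j + z0) - c * v1 j (coord j z0 + s).
  apply: (@second_derivative_max _ (g j) g1 0 _ m m0).
  - move=> s; rewrite subr0 lt_min => /andP[_ sr'].
    by apply: dg; apply: dvj; rewrite addrAC subrr add0r.
  - have l1 : (incr_order zero j j <= 1)%N by rewrite /incr_order eqxx.
    have D1 := is_derive1Ml (-1) (Sdir (incr_order zero j) j 0 l1).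
    have D2 := dv1 Kz0 i; rewrite -[X in is_derive X](addr0 (coord (Some i) z0)) in D2.
    have D3 := is_derive1Ml c (is_derive1_shift D2).
    have D4 := is_derive1B D1 D3.
    rewrite (_ : g1 = (fun s => -1 * S (incr_order zero j) (s *: dir j + z0) - c * v1 j (coord j z0 + s))).
      by apply: (is_derive_eq D4); rewrite dir0 mulN1r opprK.
    by apply/funext => s; rewrite /g1 mulN1r.
  - move=> s; rewrite subr0 lt_min => /andP[sr _]; rewrite g0.
    by apply: Fmax; exact: Kx.
have time : 0 <= - S (incr_order zero None) z0 - c * v1 None (coord None z0).
  have [r' r'0 dvj] := dv Kz0 None.
  have D := dg None 0 (v1 None (coord None z0)).
  rewrite dir0 addr0 in D.
  apply: (derive_left_max r0 (D _)); first by apply: dvj; rewrite subrr normr0.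
  by move=> s; rewrite sub0r => s1 s2; rewrite g0; apply: Fmax; exact: Kt.
have weak := weak_identity usol e01 (inQ z0 Kz0).
have absb : c0 * (V z0 - 2^-1) `^ p * c <= absorption T p h u e z0.
  apply: (absorption_ge usol e01 (massK z0 Kz0)) => w Qw wz.
  have [Ow uw] := He z0 Kz0 w wz.
  apply: ler_pM => //; [exact: powR_ge0|exact: hc0|].
  have := V1 Kz0; move: uw; rewrite ler_distl => /andP[uw _] V1z.
  by apply: ge0_ler_powR => //; rewrite ?nnegrE; lra.
have sumb : \sum_(i < N) S (incr_order (incr_order zero (Some i)) (Some i)) z0 <=
    c * \sum_(i < N) v2 (Some i) (coord (Some i) z0).
  by rewrite mulr_sumr; apply: ler_sum.
have : 0 < (v1 None (coord None z0) - \sum_(i < N) v2 (Some i) (coord (Some i) z0) +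
  c0 * (V z0 - 2^-1) `^ p) * c by rewrite mulr_gt0.
move: weak; rewrite -/(S (incr_order zero None) z0) (_ : \sum_(i < N) mollify _ _ _ _ _ =
  \sum_(i < N) S (incr_order (incr_order zero (Some i)) (Some i)) z0)// => weak.
lra.
Qed.

End comparison.

(** * Local bounds where the absorption is positive *)

Section barrier.
Variables (a r : R).
(** inv_gap blows up at both ends of the interval of centre a and radius r.  The
    same barrier is used for the time coordinate: blow-up at the final time as
    well does no harm and avoids a second profile. *)
Definition inv_gap (s : R) : R := (r ^+ 2 - (s - a) ^+ 2)^-1.
Definition barrier (A : R) (m : nat) (s : R) : R := A * inv_gap s ^+ m.
Definition barrier1 (A : R) (m : nat) (s : R) : R := A * (2 * m%:R * (s - a) * inv_gap s ^+ m.+1).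
Definition barrier2 (A : R) (m : nat) (s : R) : R :=
  A * (2 * m%:R * inv_gap s ^+ m.+1 + 4 * m%:R * m.+1%:R * (s - a) ^+ 2 * inv_gap s ^+ m.+2).

Hypothesis r01 : 0 < r <= 1.

Lemma inv_gap_ge1 s : `|s - a| < r -> 1 <= inv_gap s.
Proof.
move=> sr; have [r0 r1] := andP r01; rewrite /inv_gap.
have s2 : (s - a) ^+ 2 < r ^+ 2 by rewrite -(real_normK (num_real (s - a))) ltrXn2r// nnegrE ltW.
rewrite -[leLHS]invr1 lef_pV2 ?posrE ?subr_gt0//.
by rewrite (le_trans _ (exprn_ile1 2 (ltW r0) r1))// gerBl sqr_ge0.
Qed.

Lemma is_derive_inv_gap s : `|s - a| < r -> is_derive s 1 inv_gap (2 * (s - a) * inv_gap s ^+ 2).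
Proof.
move=> sr; have y1 := inv_gap_ge1 sr.
have yN : r ^+ 2 - (s - a) ^+ 2 != 0 by rewrite -invr_eq0 gt_eqF// (lt_le_trans ltr01 y1).
have D1 := is_derive1B (is_derive_id s (1 : R)) (is_derive_cst a s (1 : R)).
have D2 := is_derive1B (is_derive_cst (r ^+ 2) s (1 : R)) (is_derive1X 2 D1).
have D3 := @is_deriveV _ (fun s => r ^+ 2 - (s - a) ^+ 2) s _ (1 : R) yN D2.
apply: (is_derive_eq D3); rewrite /GRing.scale/= sub0r subr0 mulr1 expr1 mulrNN mulrC.
by rewrite /inv_gap exprVn.
Qed.

Lemma is_derive_barrier A n s : `|s - a| < r ->
  is_derive s 1 (barrier A n.+1) (barrier1 A n.+1 s).
Proof.
move=> sr; apply: is_derive1Ml.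
apply: (is_derive_eq (is_derive1X n.+1 (is_derive_inv_gap sr))) => /=.
by rewrite !exprS; ring.
Qed.

Lemma is_derive_barrier1 A n s : `|s - a| < r ->
  is_derive s 1 (barrier1 A n.+1) (barrier2 A n.+1 s).
Proof.
move=> sr; apply: is_derive1Ml.
have D1 := is_derive1B (is_derive_id s (1 : R)) (is_derive_cst a s (1 : R)).
have D2 := is_derive1Ml (2 * n.+1%:R) D1.
apply: (is_derive_eq (is_derive1M D2 (is_derive1X n.+2 (is_derive_inv_gap sr)))) => /=.
by rewrite !exprS; ring.
Qed.

(** One constant controls both the time derivative and the second space
    derivatives, in terms of the highest power m + 2 of inv_gap. *)
Definition barrier_const (m : nat) : R := 2 * m%:R + 4 * m%:R * m.+1%:R.

Lemma barrier2_le A m s : 0 <= A -> `|s - a| < r ->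
  barrier2 A m s <= A * barrier_const m * inv_gap s ^+ m.+2.
Proof.
move=> A0 sr; have y1 := inv_gap_ge1 sr; have [r0 r1] := andP r01.
have y0 : 0 <= inv_gap s by rewrite (le_trans ler01).
rewrite /barrier2 -[leRHS]mulrA ler_wpM2l// /barrier_const [leRHS]mulrDl lerD//.
  by rewrite ler_wpM2l ?mulr_ge0// ler_weXn2l.
rewrite ler_wpM2r ?exprn_ge0// ler_piMr ?mulr_ge0//.
rewrite -(real_normK (num_real (s - a))) exprn_ile1// ltW//.
exact: lt_le_trans r1.
Qed.

Lemma barrier1_ge A m s : 0 <= A -> `|s - a| < r ->
  - (A * barrier_const m * inv_gap s ^+ m.+2) <= barrier1 A m s.
Proof.
move=> A0 sr; have y1 := inv_gap_ge1 sr; have [r0 r1] := andP r01.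
have y0 : 0 <= inv_gap s by rewrite (le_trans ler01).
rewrite lerNl /barrier1 -mulrN -[leRHS]mulrA ler_wpM2l// -mulNr.
have [sa|sa] := leP 0 (s - a).
  rewrite (@le_trans _ _ 0)//.
    by rewrite mulr_le0_ge0 ?exprn_ge0// oppr_le0 !mulr_ge0.
  by rewrite mulr_ge0 ?exprn_ge0// addr_ge0 ?mulr_ge0.
apply: ler_pM; rewrite ?exprn_ge0 ?ler_weXn2l//.
  by rewrite -mulrN !mulr_ge0// oppr_ge0 ltW.
rewrite -mulrN (@le_trans _ _ (2 * m%:R))//; last by rewrite lerDl !mulr_ge0.
rewrite ler_piMr ?mulr_ge0// -ltr0_norm// ltW// (lt_le_trans sr)//.
Qed.

End barrier.

(** This is where m is tied to p: the p-th power of inv_gap^m dominates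
    inv_gap^(m + 2), which governs the derivatives of the barrier. *)
Lemma powR_exprn_ge (y p : R) m : 1 <= y -> m.+2%:R <= m%:R * p -> y ^+ m.+2 <= (y ^+ m) `^ p.
Proof.
move=> y1 mp; have y0 : 0 <= y by rewrite (le_trans ler01).
by rewrite -!powR_mulrn// -powRrM ler_powR.
Qed.

(** Since p > 1, a large amplitude makes the absorption beat any multiple of
    the linear terms; B is half the amplitude used below. *)
Lemma powR_absorb (p E : R) : 1 < p -> 0 <= E -> exists2 B : R, 1 <= B & B * (E + 1) = B `^ p.
Proof.
move=> p1 E0; exists ((E + 1) `^ (p - 1)^-1).
  rewrite -[leLHS](powRr0 (E + 1)) ler_powR ?lerDr//.
  by rewrite invr_ge0 subr_ge0 ltW.
rewrite -powRrM -[X in _ * X = _]powRr1 ?addr_ge0// -powRD; last first.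
  by apply/implyP => _; rewrite gt_eqF// ltr_wpDl.
congr (_ `^ _); field; rewrite subr_eq0 gt_eqF//.
Qed.

(** The bound is required for every solution, whatever its mass k: this is how
    uniformity in k is expressed. *)
Definition uniformly_bounded_near (T p : R) (h : X -> R) z0 :=
  exists r M : R, 0 < r /\ forall (k : R) u, heat_solution T p h k u ->
    forall w, (forall j, `|coord j w - coord j z0| < r) -> u w <= M.

(** The radius r' < r of the comparison box depends on u, through a bound for u
    near the boundary, but the barrier does not: its value on the half-size box
    bounds every solution. *)
Lemma keller_osserman (T p : R) (h : X -> R) z0 : 1 < p -> {within closure (QT N T), continuous h} ->
  QT N T z0 -> 0 < h z0 -> uniformly_bounded_near T p h z0.
Proof.
move=> p1 ch Qz0 hz0.
have chz z : QT N T z -> {for z, continuous h}.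
  move=> Qz; have := continuous_subspaceW (@subset_closure _ (QT N T)) ch.
  by rewrite continuous_open_subspace; [apply; rewrite inE|exact: open_QT].
pose c0 := h z0 / 2.
have c00 : 0 < c0 by rewrite divr_gt0.
pose O := (QT N T `&` [set w | c0 < h w])^°.
have oO : open O by exact: open_interior.
have OI : O `<=` QT N T `&` [set w | c0 < h w] by exact: interior_subset.
have Oz0 : nbhs z0 O.
  apply: open_nbhs_nbhs; split=> //.
  apply: filterI; first by apply: open_nbhs_nbhs; split => //; exact: open_QT.
  by apply: (cvgr_gt (h z0) (chz z0 Qz0)); rewrite /c0; lra.
have [r1 r10 r1O] := nbhs_box Oz0.
pose r : R := Num.min (r1 / 2) 1.
have [r0 rr1 r1'] : [/\ 0 < r, r < r1 & r <= 1].
  by rewrite /r; case: (leP (r1 / 2) 1) => ?; split; lra.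
have r01 : 0 < r <= 1 by rewrite r0.
have BrO : [set w | forall j, `|coord j w - coord j z0| <= r] `<=` O.
  by move=> w wr; apply: r1O => j; exact: le_lt_trans (wr j) rr1.
have [n nP] : exists n, 2 / (p - 1) <= n.+1%:R.
  exists (Num.truncn (2 / (p - 1))); exact/ltW/truncnS_gt.
pose m := n.+1.
have mp : m.+2%:R <= m%:R * p.
  move: nP; rewrite -/m ler_pdivrMr ?subr_gt0// mulrBr mulr1 lerBrDr.
  by have -> : m.+2%:R = 2 + m%:R :> R; [rewrite -[m.+2]add2n natrD|].
pose D := barrier_const m.
have D0 : 0 <= D by rewrite /D /barrier_const addr_ge0// !mulr_ge0.
pose E := 2 * D * N.+1%:R / c0.
have E0 : 0 <= E by rewrite /E divr_ge0 ?(ltW c00)// !mulr_ge0.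
have [B B1 BE] := powR_absorb p1 E0.
pose A := 2 * B.
have A0 : 0 < A by rewrite /A; lra.
exists (r / 2), ((\sum_(j : option 'I_N) A * ((r ^+ 2 - (r / 2) ^+ 2)^-1) ^+ m) + 1).
split; first by rewrite divr_gt0.
move=> k u usol w wr2.
(* This bound depends on u; it serves only to choose eta. *)
have [Mu Mu0 uMu] : exists2 Mu, 0 <= Mu & forall y, (forall j, `|coord j y - coord j z0| <= r) -> u y <= Mu.
  have cB := @compact_box z0 r.
  have cu : {within [set y | forall j, `|coord j y - coord j z0| <= r], continuous u}.
    apply: continuous_in_subspaceT => y /set_mem yB.
    by apply: (solution_continuous usol); have [] := OI _ (BrO _ yB).
  have Bn0 : [set y | forall j, `|coord j y - coord j z0| <= r] !=set0.
    by exists z0 => j /=; rewrite subrr normr0 ltW.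
  have [y0 _ y0max] := compact_EVT_max Bn0 cB cu.
  exists (Num.max 0 (u y0)); first by rewrite le_max lexx.
  by move=> y yB; rewrite le_max; apply/orP; right; apply: y0max; rewrite inE.
(* On the faces of the box of radius r - eta, the gap r^2 - r'^2 is at most
   2 eta <= 1 / (Mu + 1), so a single term of the barrier exceeds u + 1. *)
pose eta : R := Num.min (r / 2) (2 * (Mu + 1))^-1.
have eta0 : 0 < eta by rewrite lt_min divr_gt0//= invr_gt0 mulr_gt0// ltr_wpDl.
have etar : eta <= r / 2 by rewrite ge_min lexx.
have etaM : eta * (2 * (Mu + 1)) <= 1.
  by rewrite -ler_pdivlMr ?mulr_gt0 ?ltr_wpDl// div1r ge_min lexx orbT.
pose r' := r - eta.
have r'r : r' < r by rewrite /r'; lra.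
pose K := [set y : X | forall j, `|coord j y - coord j z0| <= r'].
have Kr y j : K y -> `|coord j y - coord j z0| < r by move=> Ky; exact: le_lt_trans (Ky j) r'r.
pose v (j : option 'I_N) := barrier (coord j z0) r A m.
pose v1 (j : option 'I_N) := barrier1 (coord j z0) r A m.
pose v2 (j : option 'I_N) := barrier2 (coord j z0) r A m.
pose Yb j (y : X) := inv_gap (coord j z0) r (coord j y).
have Y1 y j : K y -> 1 <= Yb j y by move=> Ky; apply: inv_gap_ge1 => //; exact: Kr.
have Vge y j : K y -> A * Yb j y ^+ m <= separable v y.
  move=> Ky; rewrite /separable (bigD1 j)//= lerDl sumr_ge0// => i _.
  by rewrite mulr_ge0 ?ltW// exprn_gt0// (lt_le_trans ltr01 (Y1 _ _ Ky)).
have Vge1 y : K y -> 1 <= separable v y.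
  move=> Ky; apply: le_trans (Vge y None Ky).
  have : 1 <= Yb None y ^+ m by rewrite exprn_ege1// Y1.
  by rewrite /A; nra.
have wK : K w by move=> j; rewrite (le_trans (ltW (wr2 j)))// /r'; lra.
apply: (@le_trans _ _ (separable v w + 1)).
  apply: (@comparison T p k h u usol _ K O c0 _ oO _ _ _ _ v v1 v2).
  - by rewrite ltW// (lt_trans ltr01).
  - exact: (@compact_box z0 r').
  - by move=> y Ky; apply: BrO => j; rewrite ltW// Kr.
  - by move=> y /OI[].
  - by rewrite ltW.
  - by move=> y /OI[_ /ltW].
  - exact: Vge1.
  - move=> y Ky j; exists (r - `|coord j y - coord j z0|); first by rewrite subr_gt0 Kr.
    move=> s sr; apply: is_derive_barrier => //.
    have tri : `|s - coord j z0| <= `|s - coord j y| + `|coord j y - coord j z0| by exact: ler_distD.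
    by lra.
  - by move=> y Ky i; apply: is_derive_barrier1 => //; exact: Kr.
  - move=> y Ky.
    have [inner|] := pselect (forall j, `|coord j y - coord j z0| < r').
      right; have [d d0 Hd] := near_inner_box inner.
      exists d; split => //.
      + by move=> i s sd j; apply: ltW; exact: Hd.
      + by move=> s s1 s2 j; apply: ltW; apply: Hd; rewrite ltr_norml s1/= (le_lt_trans s2).
      + have b1 : - (A * D * Yb None y ^+ m.+2) <= v1 None (coord None y).
          by apply: barrier1_ge; rewrite ?(ltW A0)// Kr.
        have b2 : \sum_(i < N) v2 (Some i) (coord (Some i) y) <= A * D * \sum_(i < N) Yb (Some i) y ^+ m.+2.
          rewrite mulr_sumr; apply: ler_sum => i _.
          by apply: barrier2_le; rewrite ?(ltW A0)// Kr.
        have P : B `^ p * \sum_j Yb j y ^+ m.+2 <= N.+1%:R * (separable v y - 2^-1) `^ p.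
          rewrite mulr_sumr.
          have -> : N.+1%:R * (separable v y - 2^-1) `^ p = \sum_(j : option 'I_N) (separable v y - 2^-1) `^ p.
            by rewrite sumr_const card_option card_ord mulr_natl.
          apply: ler_sum => j _.
          apply: (@le_trans _ _ ((B * Yb j y ^+ m) `^ p)).
            rewrite powRM ?(le_trans ler01)// ?exprn_ege1 ?Y1//.
            by rewrite ler_wpM2l ?powR_ge0// powR_exprn_ge// Y1.
          have Yp : 1 <= Yb j y ^+ m by rewrite exprn_ege1// Y1.
          have := Vge y j Ky; have := Vge1 y Ky; rewrite /A => V1 VA.
          have BY : 0 <= B * Yb j y ^+ m by rewrite mulr_ge0// (le_trans ler01).
          apply: ge0_ler_powR; first by rewrite ltW// (lt_trans ltr01).
          - by rewrite nnegrE.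
          - by rewrite nnegrE; lra.
          - by clear -VA V1; lra.
        pose Sg := \sum_j Yb j y ^+ m.+2.
        have SgE : Sg = Yb None y ^+ m.+2 + \sum_(i < N) Yb (Some i) y ^+ m.+2 by exact: sum_option.
        have Sg0 : 0 < Sg.
          rewrite SgE ltr_pwDl//; first by rewrite exprn_gt0// (lt_le_trans ltr01)// Y1.
          by apply: sumr_ge0 => i _; rewrite exprn_ge0// (le_trans ler01)// Y1.
        (* All the terms of Sg carry the same power of inv_gap, so summing over the
           N + 1 coordinates only costs the factor N + 1 included in E. *)
        have key : A * D * Sg < c0 * (separable v y - 2^-1) `^ p.
          have N0 : 0 < N.+1%:R :> R by rewrite ltr0n.
          rewrite -(ltr_pM2l N0).
          apply: (@lt_le_trans _ _ (c0 * (B `^ p * Sg))); last first.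
            by rewrite [leRHS]mulrCA ler_pM2l.
          rewrite -BE.
          have -> : c0 * (B * (E + 1) * Sg) = N.+1%:R * (A * D * Sg) + c0 * B * Sg.
            by rewrite /E /A; field; rewrite gt_eqF.
          by rewrite ltrDl !mulr_gt0// (lt_le_trans ltr01).
        rewrite SgE mulrDr in key.
        by lra.
    move=> /existsNP[j /negP]; rewrite -leNgt => r'j; left.
    have eqj : `|coord j y - coord j z0| = r' by apply/eqP; rewrite eq_le (Ky j).
    apply: le_trans (Vge y j Ky).
    have uy : u y <= Mu by apply: uMu => i; rewrite ltW// Kr.
    have Yj : Mu + 1 <= Yb j y.
      rewrite /Yb /inv_gap -(real_normK (num_real (coord j y - _))) eqj.
      have sq0 : 0 < r ^+ 2 - r' ^+ 2 by rewrite /r'; nra.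
      have sq2 : r ^+ 2 - r' ^+ 2 <= 2 * eta by rewrite /r'; nra.
      rewrite -[leRHS]div1r ler_pdivlMr//.
      apply: (@le_trans _ _ ((Mu + 1) * (2 * eta))); last lra.
      by rewrite ler_wpM2l// addr_ge0.
    have Ym : Yb j y <= Yb j y ^+ m by rewrite -[leLHS]expr1 ler_weXn2l// Y1.
    have := Y1 y j Ky; rewrite /A; nra.
  - exact: wK.
rewrite lerD2r; apply: ler_sum => j _.
rewrite ler_pM2l// lerXn2r ?nnegrE//.
- by rewrite (le_trans ler01)// Y1.
- by rewrite invr_ge0; nra.
rewrite lef_pV2 ?posrE.
- rewrite lerD2l lerN2 -(real_normK (num_real (coord j w - _))).
  by rewrite lerXn2r ?nnegrE// ?ltW// divr_gt0.
- by rewrite -invr_gt0 (lt_le_trans ltr01)// (Y1 w j).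
- by nra.
Qed.

(** * Propagation along a tube *)

Lemma uniformly_bounded_compact (T p : R) (h : X -> R) (C : set X) : compact C ->
  (forall z, C z -> uniformly_bounded_near T p h z) ->
  exists2 M : R, 0 <= M & forall (k : R) u, heat_solution T p h k u -> forall w, C w -> u w <= M.
Proof.
move=> /compact_near_coveringP cC loc.
have nC : \forall M \near +oo%R, C `<=` (fun z => forall (k : R) u, heat_solution T p h k u -> u z <= M).
  apply: (cC R +oo%R (fun M z => forall (k : R) u, heat_solution T p h k u -> u z <= M)) => x Cx.
  have [r [M [r0 HM]]] := loc x Cx.
  exists ([set x' | forall j, `|coord j x' - coord j x| < r], [set M' | M <= M']) => /=.
    by split; [exact: near_box|exact: (nbhs_pinfty_ge (num_real M))].
  by move=> [x' M']/= [x'r MM'] k u usol; exact: le_trans (HM k u usol x' x'r) MM'.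
have [M [MC M0]] : exists M : R, C `<=` (fun z => forall (k : R) u, heat_solution T p h k u -> u z <= M) /\ 0 <= M.
  apply: (@filter_ex _ (+oo%R : set_system R)).
  by apply: filterI => //; exact: (nbhs_pinfty_ge (num_real 0)).
by exists M => // k u usol w Cw; exact: (MC w Cw k u usol).
Qed.

(** K is the part up to time b of a closed neighbourhood of G.  At a point of the
    open neighbourhood O1 the maximum conditions can be used, because small moves in
    space or into the past remain in K; the other points
    of K form a compact set C off G, where u is bounded uniformly in k.  The
    absorption is discarded (c0 = 0). *)
Lemma tube_bound (T p b : R) (h : X -> R) (G S : set X) z1 : 0 <= p ->
  (forall w, QT N T w -> 0 <= h w) ->
  compact G -> open S -> G `<=` S -> S `<=` QT N T ->
  (forall z, S z -> z.2 <= b -> ~ G z -> uniformly_bounded_near T p h z) ->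
  G z1 -> z1.2 < b -> uniformly_bounded_near T p h z1.
Proof.
move=> p0 h0 cG oS GS SQ loc Gz1 z1b.
(* Applied to a constant function, this yields just the radius e. *)
have [e e01 He] := @uniform_scale G S (cst 0) 1 cG oS GS (fun z _ => cvg_cst 0) ltr01.
have [e0 e1] := andP e01.
pose K0 := [set z | exists2 w, G w & forall j, `|coord j z - coord j w| <= e].
pose O1 := [set z | exists2 w, G w & forall j, `|coord j z - coord j w| < e].
have coord0 j : coord j (0 : X) = 0 by case: j => [i|] //=; rewrite mxE.
have coordD j y z : coord j (y + z) = coord j y + coord j z.
  by case: j => [i|] //=; rewrite mxE.
have cK0 : compact K0.
  have -> : K0 = (fun q : X * X => q.1 + q.2) @` (G `*` [set w | forall j, `|coord j w - coord j (0 : X)| <= e]).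
    apply/seteqP; split => [z [w Gw wz]|z [[w y] /= [Gw ye] <-]].
      by exists (w, z - w); [split=> //= j; rewrite coord0 subr0 coordB|rewrite /= addrC subrK].
    by exists w => // j; rewrite coordD addrAC subrr add0r; have := ye j; rewrite coord0 subr0.
  apply: continuous_compact; last by apply: compact_setX => //; exact: (@compact_box 0 e).
  by apply: continuous_subspaceT => q; apply: cvgD; [exact: cvg_fst|exact: cvg_snd].
have oO1 : open O1.
  rewrite openE => z [w Gw wz]; apply: filterS (near_strict_box wz) => y yw.
  by exists w.
have O1K0 : O1 `<=` K0 by move=> z [w Gw wz]; exists w => // j; exact: ltW.
have K0S : K0 `<=` S by move=> z [w Gw wz]; have [] := He w Gw z wz.
pose H := [set z : X | z.2 <= b].
have clH : closed H.
  by apply: (@closed_comp _ _ snd [set s : R | s <= b]); [move=> z _; exact: cvg_snd|exact: closed_le].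
pose K := K0 `&` H.
have cK : compact K by exact: compact_closedI.
pose C := K `&` ~` O1.
have cC : compact C by apply: compact_closedI => //; exact: open_closedC.
have [M M0 HM] : exists2 M : R, 0 <= M & forall (k : R) u, heat_solution T p h k u -> forall w, C w -> u w <= M.
  apply: uniformly_bounded_compact => // z [[K0z Hz] nO1]; apply: loc => //; first exact: K0S.
  by move=> Gz; apply: nO1; exists z => // j; rewrite subrr normr0.
have O1z1 : O1 z1 by exists z1 => // j; rewrite subrr normr0.
have nK : nbhs z1 K.
  apply: filterI.
    by apply: filterS O1K0 _; apply: open_nbhs_nbhs.
  have oH : open [set z : X | z.2 < b].
    by apply: (@open_comp _ _ snd [set s : R | s < b]); [move=> z _; exact: cvg_snd|exact: open_lt].
  by apply: (@filterS _ _ _ [set z : X | z.2 < b]) => [z /ltW//|]; exact: open_nbhs_nbhs.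
have [r r0 rK] := nbhs_box nK.
exists r, (T + (M + 1) + 1); split=> // k u usol w wr.
have Kw := rK w wr.
pose v (j : option 'I_N) (s : R) := if j is None then s + (M + 1) else 0.
pose v1 (j : option 'I_N) (s : R) : R := if j is None then 1 else 0.
pose v2 (j : option 'I_N) (s : R) : R := 0.
have VE z : separable v z = z.2 + (M + 1).
  by rewrite /separable sum_option/= big1// addr0.
have dv (j : option 'I_N) (s : R) : is_derive s 1 (v j) (v1 j s).
  case: j => [i|]; first exact: is_derive_cst.
  by have := is_derive1D (is_derive_id s (1 : R)) (is_derive_cst (M + 1) s (1 : R)); rewrite addr0.
apply: (@le_trans _ _ (separable v w + 1)); last first.
  have /andP[_ wT] := SQ _ (K0S _ Kw.1).
  by rewrite VE !lerD2r ltW.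
apply: (@comparison T p k h u usol p0 K (QT N T) 0 cK (@open_QT T) _ _ (lexx 0) h0 v v1 v2).
- by move=> z [/K0S/SQ].
- by [].
- move=> z [/K0S/SQ/andP[z0 _] _]; rewrite VE; lra.
- by move=> z Kz j; exists 1.
- move=> z Kz; have [inO1|nO1] := pselect (O1 z); last first.
    left; have uM : u z <= M by apply: HM usol _ _; split.
    have /andP[z0 _] := SQ _ (K0S _ Kz.1).
    by rewrite VE; lra.
  right; have [y Gy yz] := inO1.
  have [d d0 Hd] := near_inner_box yz.
  have /andP[_ Hz] : true && (z.2 <= b) by case: Kz.
  exists d; split=> //.
  + move=> i s sd; split; first by exists y => // j; apply: ltW; exact: Hd.
    by rewrite /H/= scaler0 add0r.
  + move=> s s1 s2; split.
      by exists y => // j; apply: ltW; apply: Hd; rewrite ltr_norml s1/= (le_lt_trans s2).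
    rewrite /H/= (le_trans _ Hz)// gerDr /GRing.scale/= mulr1//.
  + by rewrite /= big1// subr0 mul0r addr0.
- exact: Kw.
Qed.

End spacetime.

(** * The curve and the limit *)

Section curve.
Context {R : realType} {V : normedModType R}.

Lemma lipschitz_within_continuous (A : set R) (f : R -> V) :
  [lipschitz f s | s in A] -> {within A, continuous f}.
Proof.
move=> /pinfty_ex_gt0[M M0 fM]; apply/subspace_continuousP => x Ax.
apply/cvgrPdist_lt => e e0.
rewrite near_withinE; near=> y => Ay.
have := fM (x, y) (conj Ax Ay); rewrite /= => /le_lt_trans; apply.
rewrite -ltr_pdivlMl// mulrC; near: y.
have eM : 0 < e / M by rewrite divr_gt0.
by exists (e / M).
Unshelve. all: by end_near. Qed.

End curve.

Section backward_curve.
Context {R : realType} {N : nat}.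
Local Notation X := ('rV[R]_N * R)%type.

(** At interior parameters the filter of points of [0, T] near s is the filter of all
    points near s, so the one-sided notion reduces to an ordinary derivative; convergence
    of the quotient of gamma is needed for the limit of the time quotient to be
    meaningful. *)
Lemma is_derive_time_within (T s : R) (gamma : R -> X) : s \in `]0, T[ ->
  derivable_within `[0, T] gamma s ->
  is_derive s 1 (fun r => (gamma r).2) (derive_within `[0, T] (fun r => (gamma r).2) s).
Proof.
rewrite in_itv/= => /andP[s0 sT] /cvg_ex[/= l cl].
have c2 : quotient_within `[0, T] (fun r => (gamma r).2) s --> l.2.
  have cs : (snd : X -> R) @ l --> l.2 by exact: cvg_snd.
  exact: (@cvg_comp _ _ _ (fun r => (r - s)^-1 *: (gamma r - gamma s)) (snd : X -> R) _ _ _ cl cs).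
have nI : \forall r \near s^', r \in `[0, T].
  apply: nbhs_dnbhs; near=> r; rewrite in_itv/=; apply/andP; split; apply: ltW; near: r.
    exact: lt_nbhsr.
  exact: lt_nbhsl.
have WE : within `[0, T]%classic s^' = s^'.
  apply/seteqP; split => P; rewrite /within/= => H; last by apply: filterS H => r Pr _.
  by apply: filterS2 nI H => r rI; apply.
rewrite /quotient_within WE in c2.
have -> : derive_within `[0, T] (fun r => (gamma r).2) s = l.2.
  by rewrite /derive_within /quotient_within WE; apply/cvg_lim.
have c3 : h^-1 *: ((gamma (h *: 1 + s)).2 - (gamma s).2) @[h --> 0^'] --> l.2.
  have sh : (h *: 1 + s) @[h --> (0 : R)^'] --> s^'.
    move=> P [/= d d0 H]; suff : \forall h \near (0 : R)^', P (h *: 1 + s) by [].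
    near=> h.
    apply: H => /=; last by rewrite scaler1 -subr_eq0 addrK; near: h; exact: nbhs_dnbhs_neq.
    by rewrite scaler1 opprD addrCA subrr addr0 normrN; near: h; exact: dnbhs0_lt.
  have := @cvg_comp _ _ _ (fun h : R => h *: 1 + s) (fun r => (r - s)^-1 *: ((gamma r).2 - (gamma s).2)) _ _ _ sh c2.
  apply: cvg_trans; apply: near_eq_cvg; near=> h.
  by rewrite /= scaler1 addrK.
split; first by apply/cvg_ex; exists l.2.
exact/cvg_lim.
Unshelve. all: by end_near. Qed.

Lemma time_decreasing (T tau0 : R) (gamma : R -> X) : 0 < tau0 ->
  {within `[0, T], continuous gamma} ->
  (forall s, s \in `[0, T] -> derivable_within `[0, T] gamma s) ->
  (forall s, s \in `]tau0, T] -> derive_within `[0, T] (fun r => (gamma r).2) s < 0) ->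
  forall x y, tau0 < x -> x < y -> y <= T -> (gamma y).2 < (gamma x).2.
Proof.
move=> tau00 cg dg neg x y tx xy yT.
have sub s : s \in `]x, y[ -> s \in `]0, T[.
  by rewrite !in_itv/= => /andP[xs sy]; apply/andP; split; lra.
have D s : s \in `]x, y[ -> is_derive s 1 (fun r => (gamma r).2) (derive_within `[0, T] (fun r => (gamma r).2) s).
  move=> /sub sI; apply: is_derive_time_within => //; apply: dg.
  by move: sI; rewrite !in_itv/= => /andP[s1 s2]; rewrite !ltW.
apply: (@ltr0_derive1_lt_cc _ (fun r => (gamma r).2) x y) => //.
- by move=> s /D[].
- move=> s sI; rewrite derive1E; have [_ ->] := D s sI; apply: neg.
  by move: sI; rewrite !in_itv/= => /andP[s1 s2]; apply/andP; split; lra.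
- have cg' : {within `[x, y], continuous gamma}.
    apply: continuous_subspaceW cg => s /=; rewrite !in_itv/= => /andP[s1 s2].
    by apply/andP; split; lra.
  by move=> s; apply: (@continuous_comp (subspace `[x, y]%classic) _ _ (gamma : subspace `[x, y]%classic -> X) (snd : X -> R)); [exact: cg'|exact: cvg_snd].
- by rewrite in_itv/= lexx ltW.
- by rewrite in_itv/= lexx ltW.
Qed.

(** The monotonicity is what ensures that the limit exists; without it lim would
    have no meaning. *)
Lemma u_infty_bound (u : R -> X -> R) z (M : R) :
  (forall k l, 0 < k -> k <= l -> u k z <= u l z) ->
  (forall k, 0 < k -> 0 <= u k z <= M) -> (`|u_infty u z| <= M%:E)%E.
Proof.
move=> mono bnd.
have c : cvg ((u k z)%:E @[k --> +oo]).
  pose f (k : R) := (u (Num.max 1 k) z)%:E.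
  have nd : nondecreasing_fun f.
    move=> k l kl; rewrite lee_fin; apply: mono; first by rewrite lt_max ltr01.
    by rewrite ge_max !le_max lexx kl orbT.
  apply/cvg_ex; exists (ereal_sup (range f)).
  apply: cvg_trans (nondecreasing_cvge nd); apply: near_eq_cvg; near=> k.
  rewrite /f max_r//; near: k; exact: (nbhs_pinfty_ge (num_real 1)).
have posk : \forall k \near +oo, (0 : R) < k by exact: (nbhs_pinfty_gt (num_real 0)).
have lb : (0 <= u_infty u z)%E.
  by apply: lime_ge => //; apply: filterS posk => k /bnd/andP[+ _]; rewrite lee_fin.
rewrite gee0_abs//; apply: lime_le => //.
by apply: filterS posk => k /bnd/andP[_ +]; rewrite lee_fin.
Unshelve. all: by end_near. Qed.

End backward_curve.

Unset Implicit Arguments.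

Theorem theoremB (R : realType) (N : nat) (T p : R)
    (gamma : R -> 'rV[R]_N * R) (h : 'rV[R]_N * R -> R)
    (u : R -> 'rV[R]_N * R -> R) (tau0 : R)
    (N_ge1 : (1 <= N)%N) (T_gt0 : 0 < T) (p_gt1 : 1 < p)
    (gamma_range : forall s : R, s \in `[0, T] -> 0 <= (gamma s).2 <= T)
    (gamma_lipschitz : [lipschitz gamma s | s in `[0, T]])
    (gamma_inj : {in `[0, T] &, injective gamma})
    (gamma0 : gamma 0 = (0, 0))
    (gamma_pos : forall s : R, s \in `]0, T] -> 0 < (gamma s).2)
    (h_cont : {within closure (QT N T), continuous h})
    (h_zero : forall z : 'rV[R]_N * R, (gamma @` `[0, T]) z -> h z = 0)
    (h_pos : forall z : 'rV[R]_N * R, (closure (QT N T) `\` gamma @` `[0, T]) z -> 0 < h z)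
    (h_integrable : forall r : R, 0 < r ->
       (\int[lebesgue_measure]_(t in `]0%R, T[)
          \int[lebesgue_rV N]_(x in eball r)
            (h (x, t) * heat_kernel x t `^ p)%:E < +oo)%E)
    (u_sol : forall k : R, 0 < k -> unique_heat_solution T p h k (u k))
    (u_incr : forall k l : R, 0 < k -> k <= l ->
       forall z, punctured_strip N T z -> u k z <= u l z)
    (gamma_C1 : C1_within `[0, T] gamma)
    (tau0_in : tau0 \in `]0, T[)
    (gamma_backward : forall s : R, s \in `]tau0, T] ->
       derive_within `[0, T] (fun r => (gamma r).2) s < 0) :
  locally_bounded_on (QT N T `\` gamma @` `[0, tau0]) (u_infty u).
Proof.
have h0 w : QT N T w -> 0 <= h w.
  move=> Qw; have [Gw|nGw] := pselect ((gamma @` `[0, T]) w); first by rewrite h_zero.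
  by apply/ltW/h_pos; split => //; exact: subset_closure.
have cg : {within `[0, T], continuous gamma} by exact: lipschitz_within_continuous.
have off z : QT N T z -> ~ (gamma @` `[0, T]) z -> uniformly_bounded_near T p h z.
  move=> Qz nGz; apply: keller_osserman => //.
  by apply: h_pos; split => //; exact: subset_closure.
move: tau0_in; rewrite in_itv/= => /andP[tau00 tau0T].
have [dgamma _] := gamma_C1.
have dec := time_decreasing tau00 cg dgamma gamma_backward.
(* The limit inherits any bound that is uniform in k. *)
suff bdd z : (QT N T `\` gamma @` `[0, tau0]) z -> uniformly_bounded_near T p h z.
  move=> z Az; have [r [M [r0 HM]]] := bdd z Az.
  exists M; rewrite near_withinE; apply: filterS (near_box z r0) => y yr [Qy _].
  have Py : punctured_strip N T y by exact: QT_punctured.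
  apply: u_infty_bound; first by move=> k l k0 kl; exact: u_incr.
  move=> k k0; have [usol _] := u_sol k k0; rewrite (HM k (u k) usol y yr) andbT.
  by have [_ + _ _ _] := usol; apply.
move=> [Qz nG0]; have [Gz|nGz] := pselect ((gamma @` `[0, T]) z); last exact: off.
have [t1 /= t1I zE] := Gz.
have /andP[t10 t1T] : 0 <= t1 <= T by move: t1I; rewrite in_itv.
have tau0t1 : tau0 < t1.
  rewrite ltNge; apply/negP => t1tau0; apply: nG0; exists t1 => //=.
  by rewrite in_itv/= t10.
(* The tube is built around the arc over [t3, T]; the margin between t2 and
   t3 separates that arc from the rest of the curve. *)
pose t2 : R := tau0 + (t1 - tau0) / 3.
pose t3 : R := tau0 + 2 * (t1 - tau0) / 3.
have [h2 h23 h31] : [/\ tau0 < t2, t2 < t3 & t3 < t1].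
  by rewrite /t2 /t3; clear -tau0t1; split; lra.
have h3 : tau0 < t3 by exact: lt_trans h23.
have t2_gt0 : 0 < t2 by exact: lt_trans h2.
have t3_gt0 : 0 < t3 by exact: lt_trans h23.
have t3T : t3 < T by exact: lt_le_trans t1T.
have t2T : t2 < T by exact: lt_trans t3T.
have inI s : 0 <= s -> s <= T -> s \in `[0, T] by move=> s0 sT; rewrite in_itv/= s0.
have compact_piece x y : 0 <= x -> y <= T -> compact (gamma @` `[x, y]).
  move=> x0 yT; apply: continuous_compact; last exact: segment_compact.
  apply: continuous_subspaceW cg => s /=; rewrite !in_itv/= => /andP[xs sy].
  by rewrite (le_trans x0 xs) (le_trans sy yT).
pose G := gamma @` `[t3, T].
pose S := QT N T `&` ~` (gamma @` `[0, t2]).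
have time32 := dec t2 t3 h2 h23 (ltW t3T).
have oS : open S.
  apply: openI; first exact: open_QT.
  apply: closed_openC; apply: compact_closed; first exact: norm_hausdorff.
  by apply: compact_piece => //; exact: ltW.
have GS : G `<=` S.
  move=> y [s /= ]; rewrite in_itv/= => /andP[s3 sT] <-.
  have s_gt0 : 0 < s by exact: lt_le_trans s3.
  split.
    rewrite /QT/= gamma_pos ?in_itv/= ?s_gt0//=.
    apply: (@lt_le_trans _ _ (gamma t2).2).
      by apply: dec => //; exact: lt_le_trans s3.
    by have /andP[] := gamma_range t2 (inI t2 (ltW t2_gt0) (ltW t2T)).
  move=> [s' /=]; rewrite in_itv/= => /andP[s'0 s'2] E.
  have := gamma_inj s' s (inI s' s'0 (le_trans s'2 (ltW t2T))) (inI s (ltW s_gt0) sT) E.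
  by move=> s's; move: s'2; rewrite s's leNgt (lt_le_trans h23).
pose b : R := ((gamma t1).2 + (gamma t3).2) / 2.
have time13 : (gamma t1).2 < (gamma t3).2 by exact: dec.
have [bt1 bt3] : (gamma t1).2 < b /\ b < (gamma t3).2.
  by rewrite /b; clear -time13; split; lra.
apply: (@tube_bound _ _ T p b h G S) => //.
- exact/ltW/(lt_trans ltr01).
- by apply: compact_piece => //; exact: ltW.
- by move=> y [].
- move=> y [Qy nG2] yb nGy; apply: off => // -[s /=]; rewrite in_itv/= => /andP[s0 sT] sE.
  have [s2|s2] := leP s t2.
    by apply: nG2; exists s => //=; rewrite in_itv/= s0.
  have [s3|s3] := leP t3 s.
    by apply: nGy; exists s => //=; rewrite in_itv/= s3.
  have : (gamma t3).2 < (gamma s).2.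
    by apply: dec => //; [exact: lt_trans s2|exact: ltW].
  by rewrite sE ltNge (le_trans yb)// ltW.
- by exists t1 => //=; rewrite in_itv/= (ltW h31).
- by rewrite -zE.
Qed.
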